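(* Let $F\colon\mathcal{W}\to\mathbb{R}^{m\times n}$ be smooth. If the differential $d(\mathcal{P}_{\mathcal{T}_0}\circ F)$ of the map $\mathcal{P}_{\mathcal{T}_0}\circ F\colon \mathcal{W}\to\mathcal{T}_0$ has constant rank $r\ge 1$ on $\mathcal{W}$, then the set $\mathcal{M}_{\mathrm{crit}}$ of Mañé critical points is a submanifold of $\mathcal{W}$ with measure zero, and its complement $\mathcal{Q}=\mathcal{W}\setminus\mathcal{M}_{\mathrm{crit}}$ is an open and dense subset of $\mathcal{W}$.
   Context: Let $m,n$ be positive integers, and write $A_i$ for the $i$-th row of a matrix $A$, regarded as a column vector. The assignment manifold is $\mathcal{W} = \{W\in\mathbb{R}^{m\times n} : W>0 \text{ entrywise},\ W\mathbf{1}_n=\mathbf{1}_m\}$, a smooth manifold all of whose tangent spaces are identified with $\mathcal{T}_0=\{V\in\mathbb{R}^{m\times n}: V\mathbf{1}_n=0\}$. $\mathcal{P}_{\mathcal{T}_0}\colon\mathbb{R}^{m\times n}\to\mathcal{T}_0$ is the orthogonal projection with respect to the matrix inner product, i.e. $(\mathcal{P}_{\mathcal{T}_0}[A])_i=(I_n-\tfrac1n\mathbf{1}_n\mathbf{1}_n^\top)A_i$. For a probability vector $p\in\mathbb{R}^n$ and $a\in\mathbb{R}^n$, $\mathrm{Var}_p(a)=\sum_j p^j (a^j)^2-\big(\sum_j p^ja^j\big)^2$. The potential associated with $F$ is $G\colon\mathcal{W}\to\mathbb{R}$, $G(W)=-\tfrac12\sum_{k=1}^m\mathrm{Var}_{W_k}(F_k(W))\le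 0$, and the set of Mañé critical points is $\mathcal{M}_{\mathrm{crit}}:=G^{-1}(0)\subset\mathcal{W}$. Submanifold means embedded submanifold (the empty set is allowed). *)

(* Defs.v *)
From HB Require Import structures.
From mathcomp Require Import all_boot all_order all_algebra.
From mathcomp Require Import all_classical all_reals all_analysis.

Set Implicit Arguments.
Unset Strict Implicit.
Unset Printing Implicit Defensive.

Import Order.TTheory GRing.Theory Num.Theory.
Import numFieldNormedType.Exports.

Local Open Scope classical_set_scope.
Local Open Scope ring_scope.

(* Calculus on a set U that is relatively open in an affine subspace of a space
   of matrices with direction T.  For X in U and V in T one has X + h V in U for
   all small h, so the directional derivative ['D_V f X] only depends on the
   values of f on U, and the tangent space of U at X is T. *)
Section Calculus.
Context {R : realType} {p q p' q' : nat}.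
Implicit Types (T : {vspace 'M[R]_(p, q)}) (U : set 'M[R]_(p, q)).
Implicit Types (f : 'M[R]_(p, q) -> 'M[R]_(p', q')).

Fixpoint Ck_on T U (k : nat) f : Prop :=
  match k with
  | 0 => {within U, continuous f}
  | k'.+1 => {within U, continuous f} /\
      forall V, V \in T ->
        (forall X, U X -> derivable f X V) /\ Ck_on T U k' ('D_V f)
  end.

Definition smooth_on T U f : Prop := forall k, Ck_on T U k f.

(* [linfun g] is the linear map that agrees with g as soon as g is linear, which
   is the case here when f is C^1. *)
Definition differential T f (X : 'M[R]_(p, q)) :
    'Hom(subvs_of T, 'M[R]_(p', q')) :=
  linfun (fun V : subvs_of T => 'D_(vsval V) f X).

Definition rank_differential T f (X : 'M[R]_(p, q)) : nat :=
  \dim (limg (differential T f X)).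

End Calculus.

(* Lebesgue null subsets of R^d.  The family of boxes is indexed by a possibly
   finite D, since for d = 0 every box has volume 1. *)
Definition null_set {R : realType} (d : nat) (A : set 'rV[R]_d) : Prop :=
  forall e : R, 0 < e ->
  exists (D : set nat) (a b : nat -> 'rV[R]_d),
    [/\ forall i, D i -> forall j, a i 0 j <= b i 0 j,
        A `<=` \bigcup_(i in D)
                 [set x : 'rV[R]_d | forall j, a i 0 j <= x 0 j <= b i 0 j] &
        (\esum_(i in D) (\prod_(j < d) (b i 0 j - a i 0 j))%:E < e%:E)%E].

(* Here M is a manifold which is a relatively open subset of an affine subspace
   with direction T. *)
Section Manifold.
Context {R : realType} {p q : nat}.
Variables (M : set 'M[R]_(p, q)) (T : {vspace 'M[R]_(p, q)}).

Definition smooth_chart (U : set 'M[R]_(p, q))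
    (phi : 'M[R]_(p, q) -> 'rV[R]_(\dim T)) : Prop :=
  [/\ U `<=` M,
      open (U : set (subspace M)),
      open (phi @` U),
      smooth_on T U phi &
      exists2 psi : 'rV[R]_(\dim T) -> 'M[R]_(p, q),
        (forall X, U X -> psi (phi X) = X) &
        smooth_on fullv (phi @` U) psi].

Definition embedded_submanifold (S : set 'M[R]_(p, q)) : Prop :=
  S `<=` M /\
  exists2 k : nat, (k <= \dim T)%N &
  forall X, S X -> exists U phi,
    [/\ smooth_chart U phi, U X &
        phi @` (U `&` S) =
        phi @` U `&`
        [set x : 'rV[R]_(\dim T) | forall j : 'I_(\dim T),
             (k <= j)%N -> x 0 j = 0]].

Definition measure_zero (S : set 'M[R]_(p, q)) : Prop :=
  forall U phi, smooth_chart U phi -> null_set (phi @` (U `&` S)).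

End Manifold.

Section AssignmentManifold.
Context {R : realType} {m n : nat}.
Implicit Types (W A : 'M[R]_(m, n)) (F : 'M[R]_(m, n) -> 'M[R]_(m, n)).

Definition assignment_manifold : set 'M[R]_(m, n) :=
  [set W : 'M[R]_(m, n) | (forall i j, 0 < W i j) /\
           W *m (const_mx 1 : 'cV[R]_n) = (const_mx 1 : 'cV[R]_m)].

Definition T0 : {vspace 'M[R]_(m, n)} :=
  lker (linfun (fun V : 'M[R]_(m, n) => V *m (const_mx 1 : 'cV[R]_n))).

(* The rows of A are multiplied by I - 1 1^T / n, which is symmetric. *)
Definition proj_T0 A : 'M[R]_(m, n) :=
  A *m (1%:M - n%:R^-1 *: ((const_mx 1 : 'cV[R]_n) *m (const_mx 1 : 'rV[R]_n))).

Definition variance_of (w a : 'rV[R]_n) : R :=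
  \sum_j w 0 j * a 0 j ^+ 2 - (\sum_j w 0 j * a 0 j) ^+ 2.

Definition potential F W : R :=
  - (2^-1 * \sum_k variance_of (row k W) (row k (F W))).

Definition mane_crit F : set 'M[R]_(m, n) :=
  assignment_manifold `&` [set W : 'M[R]_(m, n) | potential F W = 0].

End AssignmentManifold.

Arguments assignment_manifold : clear implicits.
Arguments T0 : clear implicits.

Lemma mem_T0 (R : realType) (m n : nat) (V : 'M[R]_(m, n)) :
  (V \in T0 R m n) = (V *m (const_mx 1 : 'cV[R]_n) == 0).
Proof. by rewrite memv_ker (lfunE (mulmxr (const_mx 1 : 'cV[R]_n))). Qed.

(* Main.v *)
(* A variance [Var_p a] with [p > 0] vanishes iff [a] is constant, so the Mane
   critical set is the zero set of [proj_T0 \o F].  In affine coordinates on the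
   assignment manifold this is the zero set of a smooth map G of constant rank r
   on an open subset of R^d.  The inverse function theorem gives coordinates in
   which the zero set of G is a linear subspace of codimension r.  For the
   measure: at a zero some component of G has a nonzero partial derivative, and
   strict differentiability confines its nearby zeros by a cone condition
   [|x_j - y_j| <= L max_(k != j) |x_k - y_k|], whence grid covers of small
   volume.  Density holds because G cannot vanish on a nonempty open set,
   its derivative being nonzero. *)

Require Import Defs.
From HB Require Import structures.
From mathcomp Require Import all_boot all_order all_algebra.
From mathcomp Require Import perm.
From mathcomp Require Import all_classical all_reals all_analysis.
From mathcomp Require Import ring lra.

Set Implicit Arguments.
Unset Strict Implicit.
Unset Printing Implicit Defensive.

Import Order.TTheory GRing.Theory Num.Theory.
Import numFieldNormedType.Exports.

Local Open Scope classical_set_scope.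
Local Open Scope ring_scope.

(** * Strict differentiability from continuous partial derivatives *)

(** The definitions see [F] only through derivatives along [T0], on a set that is not open among all
    matrices. The affine chart [par x = X0 + dir x] removes this obstacle: difference quotients of
    [F \o par] are literally those of [F], so regularity passes to an open set of row vectors, where
    partial derivatives express it. There one estimate carries the analysis, strict
    differentiability of C^1 maps: it gives the chain rule, the contraction behind the inverse
    function theorem, and the cone condition. Constancy of the rank serves to straighten the zero
    set: it forces the derivative to annihilate a fixed kernel at all points near a zero, not only
    at the zero itself. Since [measure_zero] quantifies over all charts, nullity is proved for the
    map read in the given chart; what has to survive that change of coordinates is only that the
    derivative is nonzero. *)

(** The difference quotients on the two sides are the same function of [h]. *)
Lemma derivable_along_line (R : realType) (V : normedModType R) (f : V -> R)
    (z v : V) (s : R) :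
  derivable f (z + s *: v) v ->
  is_derive s (1 : R) (fun t : R => f (z + t *: v)) ('D_v f (z + s *: v)).
Proof.
have E : (fun h : R =>
    h^-1 *: (f (z + (h *: (1 : R) + s) *: v) - f (z + s *: v)))
       = (fun h => h^-1 *: (f (h *: v + (z + s *: v)) - f (z + s *: v))).
  apply/funext => h; congr (_ *: (f _ - _)).
  by rewrite scalerDl addrCA [h *: 1]mulr1.
by move=> df; apply: DeriveDef; rewrite /derivable /derive E.
Qed.

(** Parametrizing the segment between 0 and [t] by [s * t] with [s] in [0, 1] covers both signs of
    [t] with one hypothesis. *)
Lemma mean_value_bound (R : realType) (g dg : R -> R) (t c : R) :
  (forall s : R, 0 <= s <= 1 ->
     is_derive (s * t) (1 : R) g (dg (s * t)) /\ `|dg (s * t)| <= c) ->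
  `|g t - g 0| <= c * `|t|.
Proof.
move=> H; have [t0|t0|->] := ltgtP t 0; last by rewrite subrr !normr0 mulr0.
- have {}H s : t <= s <= 0 -> is_derive s (1 : R) g (dg s) /\ `|dg s| <= c.
    move=> /andP[ts s0]; have := H (s / t).
    rewrite divfK ?lt_eqF// => K; apply: K.
    by rewrite ler_ndivlMr// ler_ndivrMr// mul0r mul1r s0.
  have [||s] := @MVT_segment R g dg t 0 (ltW t0).
  + by move=> s; rewrite in_itv/= => /andP[ts s0];
    apply: (H s _).1; rewrite !ltW.
  + by apply: derivable_within_continuous => s; rewrite in_itv/= => /H[] [].
  rewrite in_itv/= => /H[_ ds]; rewrite distrC sub0r => ->.
  by rewrite normrM normrN ler_wpM2r.
- have {}H s : 0 <= s <= t -> is_derive s (1 : R) g (dg s) /\ `|dg s| <= c.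
    move=> /andP[s0 ts]; have := H (s / t).
    rewrite divfK ?gt_eqF// => K; apply: K.
    by rewrite ler_pdivlMr// ler_pdivrMr// mul0r mul1r s0.
  have [||s] := @MVT_segment R g dg 0 t (ltW t0).
  + by move=> s; rewrite in_itv/= => /andP[s0 ts];
    apply: (H s _).1; rewrite !ltW.
  + by apply: derivable_within_continuous => s; rewrite in_itv/= => /H[] [].
  rewrite in_itv/= => /H[_ ds]; rewrite subr0 => ->.
  by rewrite normrM ler_wpM2r.
Qed.

Lemma line_mean_value (R : realType) (V : normedModType R) (f : V -> R)
    (z v : V) (t c : R) :
  (forall s : R, 0 <= s <= 1 -> derivable f (z + (s * t) *: v) v /\
     `|('D_v f (z + (s * t) *: v) : R)| <= c) ->
  `|f (z + t *: v) - f z| <= c * `|t|.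
Proof.
move=> H; rewrite -[X in `|_ - f X|]addr0 -[X in `|_ - f (_ + X)|](scale0r v).
apply: (@mean_value_bound R (fun u => f (z + u *: v))
  (fun u => 'D_v f (z + u *: v))) => s /H[dv dc].
by split; [exact: (derivable_along_line dv)|exact: dc].
Qed.

Section Partial.
Context {R : realType} {d : nat}.
Implicit Types (O : set 'rV[R]_d) (f g : 'rV[R]_d -> R) (x y z v : 'rV[R]_d).

Definition partial (i : 'I_d) f : 'rV[R]_d -> R := 'D_(delta_mx 0 i) f.

Definition norm1 v : R := \sum_i `|v 0 i|.

Lemma norm1_ge0 v : 0 <= norm1 v.
Proof. by apply: sumr_ge0. Qed.

Lemma rV_ballP x (e : R) y : 0 < e ->
  ball x e y <-> forall i, `|x 0 i - y 0 i| < e.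
Proof.
move=> e0; split => [[_ h] i|h]; first exact: (h 0 i).
by split => // i j; rewrite ord1; exact: h.
Qed.

Lemma coord_le_norm x i : `|x 0 i| <= `|x|.
Proof.
rewrite [leRHS]/Num.Def.normr/= mx_normrE.
exact: (le_trans _ (le_bigmax _ _ (0, i))).
Qed.

Lemma norm1_le_norm v : norm1 v <= d%:R * `|v|.
Proof.
rewrite mulr_natl -[X in _ *+ X]card_ord -sumr_const.
by apply: ler_sum => i _; exact: coord_le_norm.
Qed.

Definition mix (k : nat) x y : 'rV[R]_d :=
  \row_i (if (i < k)%N then x 0 i else y 0 i).

(* Join y to x by changing one coordinate at a time: the path stays in the ball
   because balls for the max norm are boxes. *)
Lemma partial_lipschitz f c (r e : R) :
  (forall z, ball c r z -> forall i, derivable f z (delta_mx 0 i) /\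
     `|partial i f z| <= e) ->
  forall x y, ball c r x -> ball c r y -> `|f x - f y| <= e * norm1 (x - y).
Proof.
move=> H x y cx cy; have r0 : 0 < r by case: cx.
have mix0 : mix 0 x y = y by apply/rowP => i; rewrite mxE.
have mixd : mix d x y = x by apply/rowP => i; rewrite mxE ltn_ord.
have -> : f x - f y = \sum_(k < d) (f (mix k.+1 x y) - f (mix k x y)).
  by rewrite -(big_mkord predT (fun k => f (mix k.+1 x y) - f (mix k x y)))
    telescope_sumr// mixd mix0.
rewrite /norm1 mulr_sumr (le_trans (ler_norm_sum _ _ _))//.
apply: ler_sum => k _; rewrite !mxE.
set t := x 0 k - y 0 k.
have mixS : mix k.+1 x y = mix k x y + t *: delta_mx 0 k.
  apply/rowP => i; rewrite !mxE ltnS /= leq_eqVlt.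
  have [->|ik] := eqVneq i k; first by rewrite eqxx ltnn/= mulr1 addrC subrK.
  by rewrite mulr0 addr0 (inj_eq val_inj) (negPf ik).
have inball s : 0 <= s <= 1 -> ball c r (mix k x y + (s * t) *: delta_mx 0 k).
  move=> /andP[s0 s1]; apply/rV_ballP => // i; rewrite !mxE/=.
  have /rV_ballP-/(_ r0)/(_ i) cxi := cx.
  have /rV_ballP-/(_ r0)/(_ i) cyi := cy.
  have [ik|ik] := eqVneq i k; last by rewrite mulr0 addr0; case: ifP.
  rewrite ik ltnn mulr1 -ik in cxi cyi *.
  have -> : c 0 i - (y 0 i + s * t)
          = s * (c 0 i - x 0 i) + (1 - s) * (c 0 i - y 0 i).
    by rewrite /t -ik; ring.
  rewrite (le_lt_trans (ler_normD _ _))// !normrM (ger0_norm s0).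
  rewrite (@ger0_norm _ (1 - s)) ?subr_ge0//.
  (* Strictness is taken from the [x] term of the convex combination, whose weight is [s]; for
     [s = 0] the coordinate is that of [y]. *)
  have [->|sn0] := eqVneq s 0; first by rewrite mul0r add0r subr0 mul1r.
  have s'0 : 0 < s by rewrite lt_def sn0.
  have : s * `|c 0 i - x 0 i| < s * r by rewrite ltr_pM2l.
  have : (1 - s) * `|c 0 i - y 0 i| <= (1 - s) * r.
    by rewrite ler_wpM2l ?subr_ge0// ltW.
  lra.
by rewrite mixS; apply: line_mean_value => s s01; exact: H (inball _ s01) k.
Qed.

(** Apply [partial_lipschitz] to [f - l], with [l] the linear form built from the partial
    derivatives at [a]: the partial derivatives of the difference are at most [e] near [a]. *)
Lemma partial_strict f a :
  (\forall x \near a, forall i, derivable f x (delta_mx 0 i)) ->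
  (forall i, partial i f x @[x --> a] --> partial i f a) ->
  forall e, 0 < e -> exists2 r, 0 < r &
    forall x y, ball a r x -> ball a r y ->
    `|f x - f y - \sum_i (x - y) 0 i * partial i f a| <= e * norm1 (x - y).
Proof.
move=> df cf e e0.
have : \forall x \near a, forall i, derivable f x (delta_mx 0 i) /\
    `|partial i f a - partial i f x| <= e.
  near=> x => i; split; first by move: i; near: x.
  move: i; near: x; apply: filter_forall => i.
  by have /cvgrPdist_le/(_ _ e0) := cf i.
move=> /nbhs_ballP[r /= r0 H]; exists r => // x y ax ay.
pose l (z : 'rV[R]_d) : R := \sum_i z 0 i * partial i f a.
have lD z i h : l (h *: delta_mx 0 i + z) = h * partial i f a + l z.
  rewrite /l (bigD1 i)//= [in RHS](bigD1 i)//= !mxE !eqxx mulr1 mulrDl -addrA.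
  congr (_ + (_ + _)); apply: eq_bigr => j ji.
  by rewrite !mxE (negPf ji) andbF mulr0 add0r.
have dl z i : is_derive z (delta_mx 0 i) l (partial i f a).
  have E : (fun h : R => h^-1 *: (l (h *: delta_mx 0 i + z) - l z)) @ 0^' -->
      partial i f a.
    apply: cvg_near_cst; near=> h.
    rewrite lD addrK [_ *: _]mulrA mulVf ?mul1r//.
    by near: h; exact: nbhs_dnbhs_neq.
  by apply: DeriveDef; [apply/cvg_ex; exists (partial i f a)|exact/cvg_lim].
have := @partial_lipschitz (f - l) a r e _ x y ax ay.
rewrite [X in `|X| <= _](_ : _ =
  f x - f y - \sum_i (x - y) 0 i * partial i f a).
  apply => z az i; have [dfz dfe] := H z az i.
  have dlz := ex_derive (is_derive := dl z i).
  split; first exact: (derivableB dfz dlz).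
  rewrite /partial (deriveB dfz dlz) (derive_val (is_derive := dl z i)).
  by rewrite distrC.
have -> : \sum_i (x - y) 0 i * partial i f a = l x - l y.
  by rewrite /l -sumrB; apply: eq_bigr => i _; rewrite !mxE; ring.
by change (f x - l x - (f y - l y) = f x - f y - (l x - l y)); ring.
Unshelve. all: by end_near. Qed.

End Partial.

Lemma cvg_sumr (R : realType) (T I : Type) (F : set_system T) (r : seq I)
    (P : pred I) (f : I -> T -> R) (a : I -> R) : Filter F ->
  (forall i, P i -> f i x @[x --> F] --> a i) ->
  \sum_(i <- r | P i) f i x @[x --> F] --> \sum_(i <- r | P i) a i.
Proof. by move=> FF; apply: cvg_big => //; exact: add_continuous. Qed.

Lemma derivable_cvg (R : realType) (V : normedModType R) (f : V -> R) x v :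
  derivable f x v ->
  (fun h : R => h^-1 * (f (h *: v + x) - f x)) @ 0^' --> ('D_v f x : R).
Proof. by []. Qed.

Lemma cvg_is_derive (R : realType) (V : normedModType R) (f : V -> R) x v
    (l : R) :
  (fun h : R => h^-1 * (f (h *: v + x) - f x)) @ 0^' --> l ->
  is_derive x v f l.
Proof.
by move=> fl; apply: DeriveDef; [apply/cvg_ex; exists l|exact/cvg_lim].
Qed.

(** Fréchet differentiability, with the linear form given by the partial derivatives as the only
    candidate for the differential. *)
Definition diff_at (R : realType) (d : nat) (g : 'rV[R]_d -> R) (a : 'rV_d) :=
  forall e : R, 0 < e -> exists2 r : R, 0 < r & forall x, ball a r x ->
  `|g x - g a - \sum_i (x - a) 0 i * partial i g a| <= e * norm1 (x - a).

(** The difference quotients [q j] of the components stay bounded as [h] tends to 0, so the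
    remainder of [g], divided by [h], tends to 0. Differentiability of [f] along the single
    direction [v] is enough. *)
Lemma chain_rule (R : realType) (V : normedModType R) (d : nat)
    (f : V -> 'rV[R]_d) (g : 'rV[R]_d -> R) (x v : V) :
  (forall j, derivable (fun y => f y 0 j) x v) -> diff_at g (f x) ->
  is_derive x v (g \o f) (\sum_j 'D_v (fun y => f y 0 j) x * partial j g (f x)).
Proof.
move=> df dg; apply: cvg_is_derive.
pose q j (h : R) : R := h^-1 * (f (h *: v + x) 0 j - f x 0 j).
have qcvg j : q j @ 0^' --> ('D_v (fun y => f y 0 j) x : R).
  exact: (derivable_cvg (df j)).
(* Each [q j] is eventually within 1 of its limit; the last [+ 1] keeps [C] positive when
   [d = 0]. *)
pose C : R := \sum_j (`|'D_v (fun y => f y 0 j) x : R| + 1) + 1.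
have C0 : 0 < C by rewrite ltr_wpDl// sumr_ge0// => j _; rewrite addr_ge0.
have qC : \forall h \near 0^', \sum_j `|q j h| <= C.
  near=> h.
  rewrite ler_wpDr// ler_sum// => j _.
  move: j; near: h; apply: filter_forall => j.
  have /cvgrPdist_le/(_ 1 ltr01) := qcvg j; apply: filterS => h.
  by move=> H; rewrite addrC -lerBlDr (le_trans (lerB_dist _ _))// distrC.
have main : (fun h => \sum_j q j h * partial j g (f x)) @ 0^' -->
    \sum_j ('D_v (fun y => f y 0 j) x : R) * partial j g (f x).
  apply: cvg_sumr => j _; apply: cvgM; [exact: qcvg|exact: cvg_cst].
apply/cvgrPdist_le => e e0.
have e20 : 0 < e / 2 by rewrite divr_gt0.
have [r r0 H] := dg (e / 2 / C) (divr_gt0 e20 C0).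
near=> h.
have h0 : h != 0 by near: h; exact: nbhs_dnbhs_neq.
have qh : \sum_j `|q j h| <= C by near: h.
have fq j : f (h *: v + x) 0 j - f x 0 j = h * q j h by rewrite mulVKf.
have n1 : norm1 (f (h *: v + x) - f x) = `|h| * \sum_j `|q j h|.
  by rewrite mulr_sumr; apply: eq_bigr => j _; rewrite !mxE fq normrM.
have inb : ball (f x) r (f (h *: v + x)).
  apply/rV_ballP => // j; rewrite distrC fq normrM.
  have hr : `|h| * C < r.
    rewrite -ltr_pdivlMr//; near: h; apply: dnbhs0_lt; exact: divr_gt0.
  rewrite (le_lt_trans _ hr)// ler_wpM2l// (le_trans _ qh)// (bigD1 j)//=.
  by rewrite lerDl sumr_ge0.
rewrite (splitr e).
have m2 : `|\sum_j ('D_v (fun y => f y 0 j) x : R) * partial j g (f x) -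
    \sum_j q j h * partial j g (f x)| <= e / 2.
  by near: h; move/cvgrPdist_le : main; apply.
rewrite -[X in `|X - _|](subrK (\sum_j q j h * partial j g (f x))) -addrA.
rewrite (le_trans (ler_normD _ _))// lerD//.
have {H} := H _ inb; rewrite n1 => H.
have -> : \sum_j q j h * partial j g (f x) - h^-1 * ((g \o f) (h *: v + x) -
    (g \o f) x) = - h^-1 * (g (f (h *: v + x)) - g (f x) -
    \sum_i (f (h *: v + x) - f x) 0 i * partial i g (f x)).
  have -> : \sum_i (f (h *: v + x) - f x) 0 i * partial i g (f x) =
      h * \sum_j q j h * partial j g (f x).
    by rewrite mulr_sumr; apply: eq_bigr => i _; rewrite !mxE fq mulrA.
  by rewrite /=; field.
rewrite normrM normrN normfV ler_pdivrMl ?normr_gt0//.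
rewrite (le_trans H)// mulrCA ler_wpM2l//.
by rewrite mulrAC ler_pdivrMr// ler_wpM2l// ltW.
Unshelve. all: by end_near. Qed.

(** * Scalar functions of class C^k *)

Section Ck.
Context {R : realType} {d : nat}.
Implicit Types (O : set 'rV[R]_d) (f g : 'rV[R]_d -> R) (x y z v : 'rV[R]_d).

(** Coordinate directions suffice: on an open set, continuity of the first partial derivatives gives
    the derivative in every direction ([C1_derive]). *)
Fixpoint Ck O (k : nat) f : Prop :=
  match k with
  | 0 => forall x, O x -> {for x, continuous f}
  | k'.+1 => (forall x, O x -> {for x, continuous f}) /\
      forall i, (forall x, O x -> derivable f x (delta_mx 0 i)) /\
                Ck O k' (partial i f)
  end.

Definition smooth O f := forall k, Ck O k f.

Lemma Ck_continuous O k f x : Ck O k f -> O x -> {for x, continuous f}.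
Proof. by case: k => [|k] => [H|[H _]]; exact: H. Qed.

Lemma CkS O k f : Ck O k.+1 f -> Ck O k f.
Proof.
elim: k f => [|k IH] f; first by case.
by case=> cf H; split => // i; have [df /IH] := H i.
Qed.

Lemma Ck_sub O O' k f : O' `<=` O -> Ck O k f -> Ck O' k f.
Proof.
move=> sub; elim: k f => [f H x /sub|k IH f [H1 H2]]; first exact: H.
split=> [x /sub|i]; first exact: H1.
by have [df Df] := H2 i; split=> [x /sub|]; [exact: df|exact: IH].
Qed.

(** Openness turns equality on [O] into equality near each of its points, which is what derivatives
    depend on. *)
Lemma Ck_ext O k f g : open O -> (forall x, O x -> f x = g x) ->
  Ck O k f -> Ck O k g.
Proof.
move=> oO; elim: k f g => [|k IH] f g fg; have nfg x : O x ->
    (\forall y \near x, f y = g y) by move=> Ox;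
    apply: filterS (open_nbhs_nbhs (conj oO Ox)) => y; exact: fg.
  move=> cf x Ox; rewrite /prop_for /continuous_at -(fg x Ox).
  exact: cvg_trans (near_eq_cvg (nfg x Ox)) (cf x Ox).
move=> [cf df]; split=> [x Ox|i].
  rewrite /prop_for /continuous_at -(fg x Ox).
  exact: cvg_trans (near_eq_cvg (nfg x Ox)) (cf x Ox).
have [dfi Dfi] := df i; split=> [x Ox|].
  exact: (near_eq_derivable (nfg x Ox) (dfi x Ox)).
by apply: IH Dfi => x Ox; exact: (near_eq_derive _ (nfg x Ox)).
Qed.

Lemma Ck_cst O k (c : R) : Ck O k (fun _ => c).
Proof.
elim: k c => [|k IH] c; first by move=> x _; exact: cst_continuous.
split=> [x _|i]; first exact: cst_continuous.
split=> [x _|]; first exact: derivable_cst.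
rewrite /partial (_ : 'D_ _ _ = fun=> 0)//.
by apply/funext => x; exact: derive_cst.
Qed.

Lemma coordD (j : 'I_d) x v :
  is_derive x v (fun z : 'rV[R]_d => z 0 j) (v 0 j).
Proof.
apply: cvg_is_derive; apply: cvg_near_cst; near=> h.
rewrite !mxE addrK mulKf//; near: h; exact: nbhs_dnbhs_neq.
Unshelve. all: by end_near. Qed.

Lemma Ck_coord O k j : Ck O k (fun x => x 0 j).
Proof.
case: k => [|k]; first by move=> x _; exact: coord_continuous.
split=> [x _|i]; first exact: coord_continuous.
split=> [x _|]; first exact: (ex_derive (is_derive := coordD j x _)).
rewrite /partial (_ : 'D_ _ _ = fun=> (delta_mx 0 i : 'rV[R]_d) 0 j).
  exact: Ck_cst.
by apply/funext => x; exact: (derive_val (is_derive := coordD j x _)).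
Qed.

Lemma CkD O k f g : open O -> Ck O k f -> Ck O k g ->
  Ck O k (fun x => f x + g x).
Proof.
move=> oO; elim: k f g => [|k IH] f g cf cg.
  by move=> x Ox; apply: (cvgD (cf x Ox) (cg x Ox)).
have [cf1 df] := cf; have [cg1 dg] := cg; split=> [x Ox|i].
  exact: (cvgD (cf1 x Ox) (cg1 x Ox)).
have [dfi Dfi] := df i; have [dgi Dgi] := dg i; split=> [x Ox|].
  exact: (derivableD (dfi x Ox) (dgi x Ox)).
apply: Ck_ext (IH _ _ Dfi Dgi) => // x Ox.
exact/esym/(deriveD (dfi x Ox) (dgi x Ox)).
Qed.

Lemma CkM O k f g : open O -> Ck O k f -> Ck O k g ->
  Ck O k (fun x => f x * g x).
Proof.
move=> oO; elim: k f g => [|k IH] f g cf cg.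
  by move=> x Ox; apply: (cvgM (cf x Ox) (cg x Ox)).
have [cf1 df] := cf; have [cg1 dg] := cg; split=> [x Ox|i].
  exact: (cvgM (cf1 x Ox) (cg1 x Ox)).
have [dfi Dfi] := df i; have [dgi Dgi] := dg i; split=> [x Ox|].
  exact: (derivableM (dfi x Ox) (dgi x Ox)).
apply: Ck_ext (CkD oO (IH _ _ (CkS cf) Dgi) (IH _ _ (CkS cg) Dfi)) => // x Ox.
exact/esym/(deriveM (dfi x Ox) (dgi x Ox)).
Qed.

Lemma Ck_sum O k (I : Type) (r : seq I) (P : pred I) (F : I -> 'rV[R]_d -> R) :
  open O -> (forall i, P i -> Ck O k (F i)) ->
  Ck O k (fun x => \sum_(i <- r | P i) F i x).
Proof.
move=> oO H; elim: r => [|i r IH].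
  rewrite (_ : (fun x => \sum_(i <- [::] | P i) F i x) = fun=> 0).
    exact: Ck_cst.
  by apply/funext => x; rewrite big_nil.
rewrite (_ : (fun x => \sum_(i <- i :: r | P i) F i x) = fun x =>
    if P i then F i x + \sum_(i <- r | P i) F i x
    else \sum_(i <- r | P i) F i x).
  2: by apply/funext => x; rewrite big_cons.
by case Pi: (P i) => //; apply: CkD => //; exact: H.
Qed.

Lemma Ck_prod O k (I : Type) (r : seq I) (P : pred I) (F : I -> 'rV[R]_d -> R) :
  open O -> (forall i, P i -> Ck O k (F i)) ->
  Ck O k (fun x => \prod_(i <- r | P i) F i x).
Proof.
move=> oO H; elim: r => [|i r IH].
  rewrite (_ : (fun x => \prod_(i <- [::] | P i) F i x) = fun=> 1).
    exact: Ck_cst.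
  by apply/funext => x; rewrite big_nil.
rewrite (_ : (fun x => \prod_(i <- i :: r | P i) F i x) = fun x =>
    if P i then F i x * \prod_(i <- r | P i) F i x
    else \prod_(i <- r | P i) F i x).
  2: by apply/funext => x; rewrite big_cons.
by case Pi: (P i) => //; apply: CkM => //; exact: H.
Qed.

Lemma CkV O k f : open O -> (forall x, O x -> f x != 0) -> Ck O k f ->
  Ck O k (fun x => (f x)^-1).
Proof.
move=> oO f0; elim: k => [|k IH] cf.
  by move=> x Ox; exact: (cvgV (f0 x Ox) (cf x Ox)).
have [cf1 df] := cf; split=> [x Ox|i].
  exact: (cvgV (f0 x Ox) (cf1 x Ox)).
have [dfi Dfi] := df i; split=> [x Ox|].
  exact: (derivableV (f0 x Ox) (dfi x Ox)).
have CV := IH (CkS cf).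
apply: Ck_ext (CkM oO (Ck_cst O k (-1)) (CkM oO (CkM oO CV CV) Dfi)) => // x Ox.
rewrite /partial (deriveV (f0 x Ox) (dfi x Ox)) -exprVn.
by rewrite [RHS]mulNr mulN1r expr2.
Qed.

Lemma Ck_det n O k (M : 'rV[R]_d -> 'M[R]_n) : open O ->
  (forall i j, Ck O k (fun x => M x i j)) -> Ck O k (fun x => \det (M x)).
Proof.
move=> oO H; apply: Ck_sum => // s _; apply: CkM => //; first exact: Ck_cst.
by apply: Ck_prod.
Qed.

(** Cramer's rule: an entry of the inverse is a cofactor divided by the determinant. *)
Lemma Ck_invmx n O k (M : 'rV[R]_d -> 'M[R]_n) i j : open O ->
  (forall x, O x -> M x \in unitmx) ->
  (forall i j, Ck O k (fun x => M x i j)) -> Ck O k (fun x => invmx (M x) i j).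
Proof.
move=> oO uM H.
have E x : O x -> (\det (M x))^-1 *
    ((-1) ^+ (j + i) * \det (row' j (col' i (M x)))) = invmx (M x) i j.
  by move=> Ox; rewrite /invmx uM// !mxE.
have dV : Ck O k (fun x => (\det (M x))^-1).
  apply: (CkV (f := fun x => \det (M x))) => //; last exact: Ck_det.
  by move=> x /uM; rewrite unitmxE unitfE.
apply: Ck_ext oO E (CkM oO dV (CkM oO (Ck_cst _ _ _) (Ck_det oO _))) => a b.
rewrite (_ : (fun x => _) = fun x => M x (lift j a) (lift i b)); first exact: H.
by apply/funext => x; rewrite !mxE.
Qed.

Lemma C1_strict O f a : open O -> Ck O 1 f -> O a ->
  forall e, 0 < e -> exists2 r, 0 < r &
    forall x y, ball a r x -> ball a r y ->
    `|f x - f y - \sum_i (x - y) 0 i * partial i f a| <= e * norm1 (x - y).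
Proof.
move=> oO [cf df] Oa; apply: partial_strict => [|i].
  apply: filterS (open_nbhs_nbhs (conj oO Oa)) => x Ox i.
  by have [H _] := df i; exact: H.
by have [_ H] := df i; exact: H.
Qed.

Lemma C1_diff_at O f a : open O -> Ck O 1 f -> O a -> diff_at f a.
Proof.
move=> oO Cf Oa e e0; have [r r0 H] := C1_strict oO Cf Oa e0.
by exists r => // x ax; apply: H => //; exact: ballxx.
Qed.

(** The chain rule for the identity map, whose coordinate functions have derivatives [v 0 j] along
    [v]. *)
Lemma C1_derive O f a v : open O -> Ck O 1 f -> O a ->
  is_derive a v f (\sum_i v 0 i * partial i f a).
Proof.
move=> oO Cf Oa.
have := chain_rule (fun j => ex_derive (is_derive := coordD j a v))
  (C1_diff_at oO Cf Oa).
by under eq_bigr => j do rewrite (derive_val (is_derive := coordD j a v)).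
Qed.

End Ck.

Lemma mx_cvg (R : realType) (T : Type) (m n : nat) (F : set_system T) :
  Filter F -> forall (f : T -> 'M[R]_(m, n)) (a : 'M[R]_(m, n)),
  (forall i j, f t i j @[t --> F] --> a i j) -> f @ F --> a.
Proof.
move=> FF f a fa; apply/cvgrPdist_lt => r r0; near=> t.
suff : ball a r (f t) by rewrite -ball_normE.
split=> // i j; move: i j; near: t; apply: filter_forall => i.
apply: filter_forall => j.
by have /cvgrPdist_lt/(_ r r0) := fa i j.
Unshelve. all: by end_near. Qed.

Lemma rV_cvg (R : realType) (T : Type) (n : nat) (F : set_system T) :
  Filter F -> forall (f : T -> 'rV[R]_n) (a : 'rV[R]_n),
  (forall j, f t 0 j @[t --> F] --> a 0 j) -> f @ F --> a.
Proof. by move=> FF f a fa; apply: mx_cvg => i j; rewrite ord1; exact: fa. Qed.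

(** By the chain rule a partial derivative of [g \o f] is a sum of products of some [partial i] of
    [f] with [partial j g \o f]; the induction on [k], for all [g], covers the second factor. *)
Lemma Ck_comp (R : realType) (d e : nat) (O : set 'rV[R]_d) (O' : set 'rV[R]_e)
    (k : nat) (f : 'rV[R]_d -> 'rV[R]_e) (g : 'rV[R]_e -> R) :
  open O -> open O' -> (forall x, O x -> O' (f x)) ->
  (forall j, Ck O k (fun x => f x 0 j)) -> Ck O' k g -> Ck O k (g \o f).
Proof.
move=> oO oO' fO; have cont g' :
    (forall j x, O x -> {for x, continuous (fun x => f x 0 j)}) ->
    (forall y, O' y -> {for y, continuous g'}) ->
    forall x, O x -> {for x, continuous ((g' : 'rV[R]_e -> R) \o f)}.
  move=> cf cg x Ox; apply: continuous_comp; last exact/cg/fO.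
  exact: (@rV_cvg _ _ _ _ (nbhs_filter x) f (f x) (fun j => cf j x Ox)).
elim: k g => [|k IH] g Cf Cg; first exact: cont.
have [cg dg] := Cg; split=> [|i].
  by apply: cont => // j x Ox; exact: Ck_continuous (Cf j) Ox.
have ch x : O x -> is_derive x (delta_mx 0 i) (g \o f)
    (\sum_j partial i (fun y => f y 0 j) x * partial j g (f x)).
  move=> Ox; apply: chain_rule => [j|].
    by have [_ /(_ i)[H _]] := Cf j; exact: H.
  apply: C1_diff_at oO' _ (fO x Ox).
  split=> // j; have [dgj Dgj] := dg j; split=> // y.
  exact: Ck_continuous Dgj.
split=> [x /ch H|]; first exact: (ex_derive (is_derive := H)).
have E x : O x -> \sum_j partial i (fun y => f y 0 j) x * partial j g (f x) =
    partial i (g \o f) x.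
  by move=> /ch H; rewrite /partial (derive_val (is_derive := H)).
apply: (@Ck_ext _ _ O k (fun x => \sum_j
  partial i (fun y => f y 0 j) x * partial j g (f x)) _ oO E).
apply: Ck_sum => // j _.
exact: (CkM oO ((Cf j).2 i).2 (IH _ (fun j' => CkS (Cf j')) (dg j).2)).
Qed.

(** * Vector-valued maps and their Jacobian matrices *)

Section VectorCalculus.
Context {R : realType}.

(** Transposed with respect to the usual convention: vectors are rows, the differential is
    [v *m jac f x], and the chain rule multiplies from left to right. *)
Definition jac d e (f : 'rV[R]_d -> 'rV[R]_e) x : 'M[R]_(d, e) :=
  \matrix_(i, j) partial i (fun y => f y 0 j) x.

Definition smoothv d e (O : set 'rV[R]_d) (f : 'rV[R]_d -> 'rV[R]_e) :=
  forall j k, Ck O k (fun x => f x 0 j).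

Lemma smoothv_derive d e O (f : 'rV[R]_d -> 'rV[R]_e) x v j :
  open O -> smoothv O f -> O x ->
  is_derive x v (fun y => f y 0 j) ((v *m jac f x) 0 j).
Proof.
move=> oO sf Ox; rewrite mxE.
under eq_bigr => i _ do rewrite mxE.
exact: C1_derive oO (sf j 1) Ox.
Qed.

Lemma smoothv_continuous d e O (f : 'rV[R]_d -> 'rV[R]_e) x :
  smoothv O f -> O x -> {for x, continuous f}.
Proof.
move=> sf Ox; apply: (@rV_cvg _ _ _ _ (nbhs_filter x) f (f x)) => j.
exact: Ck_continuous (sf j 0%N) Ox.
Qed.

Lemma smoothv_sub d e (O O' : set 'rV[R]_d) (f : 'rV[R]_d -> 'rV[R]_e) :
  O' `<=` O -> smoothv O f -> smoothv O' f.
Proof. by move=> OO' sf j k; apply: Ck_sub OO' (sf j k). Qed.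

Lemma smoothv_comp d e l (O : set 'rV[R]_d) (O' : set 'rV[R]_e)
    (f : 'rV[R]_d -> 'rV[R]_e) (g : 'rV[R]_e -> 'rV[R]_l) :
  open O -> open O' -> (forall x, O x -> O' (f x)) ->
  smoothv O f -> smoothv O' g -> smoothv O (g \o f).
Proof.
move=> oO oO' fO sf sg j k.
exact: (Ck_comp oO oO' fO (fun j' => sf j' k) (sg j k)).
Qed.

Lemma jac_comp d e l (O : set 'rV[R]_d) (O' : set 'rV[R]_e)
    (f : 'rV[R]_d -> 'rV[R]_e) (g : 'rV[R]_e -> 'rV[R]_l) x :
  open O -> open O' -> smoothv O f -> smoothv O' g -> O x -> O' (f x) ->
  jac (g \o f) x = jac f x *m jac g (f x).
Proof.
move=> oO oO' sf sg Ox O'fx; apply/matrixP => i k; rewrite !mxE.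
have df j : derivable (fun y => f y 0 j) x (delta_mx 0 i).
  exact: (ex_derive (is_derive := smoothv_derive (delta_mx 0 i) j oO sf Ox)).
have H := chain_rule df (C1_diff_at oO' (sg k 1) O'fx).
rewrite /partial (derive_val (is_derive := H)).
by apply: eq_bigr => j _; rewrite !mxE.
Qed.

Lemma jac_linear d e (A : 'M[R]_(d, e)) x : jac (mulmxr A) x = A.
Proof.
apply/matrixP => i j; rewrite mxE /partial.
have E : is_derive x (delta_mx 0 i) (fun y => (y *m A) 0 j) (A i j).
  apply: cvg_is_derive; apply: cvg_near_cst; near=> h.
  rewrite mulmxDl -scalemxAl -rowE !mxE addrK mulKf//.
  near: h; exact: nbhs_dnbhs_neq.
exact: (derive_val (is_derive := E)).
Unshelve. all: by end_near. Qed.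

Lemma smoothv_linear d e O (f : 'rV[R]_d -> 'rV[R]_e) l (A : 'M[R]_(e, l)) :
  open O -> smoothv O f -> smoothv O (fun x => f x *m A).
Proof.
move=> oO sf j k.
rewrite (_ : (fun x => _) = fun x => \sum_i f x 0 i * A i j).
  by apply: Ck_sum => // i _; exact: (CkM oO (sf i k) (Ck_cst _ _ _)).
by apply/funext => x; rewrite mxE.
Qed.

Lemma smoothvD d e O (f g : 'rV[R]_d -> 'rV[R]_e) :
  open O -> smoothv O f -> smoothv O g -> smoothv O (fun x => f x + g x).
Proof.
move=> oO sf sg j k.
rewrite (_ : (fun x => _) = fun x => f x 0 j + g x 0 j).
  exact: (CkD oO (sf j k) (sg j k)).
by apply/funext => x; rewrite mxE.
Qed.

Lemma smoothv_id d (O : set 'rV[R]_d) : smoothv O id.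
Proof. by move=> j k; exact: Ck_coord. Qed.

(** Turns conditions inherited by smaller radii into filter statements, so that finitely many of
    them share one radius. *)
Lemma nbhs0_right (P : R -> Prop) :
  (forall r s, 0 < r -> r <= s -> P s -> P r) -> (exists2 r, 0 < r & P r) ->
  \forall r \near 0^'+, P r.
Proof.
move=> mono [s s0 Ps]; near=> r; apply: (mono r s) => //.
near: r; exact: nbhs_right_le.
Unshelve. all: by end_near. Qed.

Lemma smoothv_strict d e O (f : 'rV[R]_d -> 'rV[R]_e) a (eps : R) :
  open O -> smoothv O f -> O a -> 0 < eps ->
  exists2 r : R, 0 < r & ball a r `<=` O /\
    forall x y, ball a r x -> ball a r y -> forall j,
    `|(f x - f y - (x - y) *m jac f a) 0 j| <= eps * norm1 (x - y).
Proof.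
move=> oO sf Oa e0.
pose P r := ball a r `<=` O.
pose Q j r := forall x y, ball a r x -> ball a r y ->
    `|(f x - f y - (x - y) *m jac f a) 0 j| <= eps * norm1 (x - y).
have Pr : \forall r \near 0^'+, P r.
  apply: nbhs0_right => [r s r0 rs Ps|].
    exact: subset_trans (le_ball rs) Ps.
  by have /nbhs_ballP[r /= r0 H] := open_nbhs_nbhs (conj oO Oa); exists r.
have Qr : \forall r \near 0^'+, forall j, Q j r.
  apply: filter_forall => j; apply: nbhs0_right => [r s r0 rs Qs x y ax ay|].
    by apply: Qs; exact: (le_ball rs).
  have [r r0 H] := C1_strict oO (sf j 1) Oa e0; exists r => // x y ax ay.
  have := H x y ax ay; rewrite !mxE.
  by under [in X in _ -> X]eq_bigr => i _ do rewrite [jac f a i j]mxE.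
have [r [[Pr0 Qr0] r0]] : exists r, (P r /\ forall j, Q j r) /\ 0 < r.
  apply: (@filter_ex _ (0^'+ : set_system R)).
  by near=> r; split; [split; near: r|near: r; exact: nbhs_right_gt].
by exists r => //; split => // x y ax ay j; exact: Qr0.
Unshelve. all: by end_near. Qed.

Lemma mx_norm_le m n (M : 'M[R]_(m, n)) c : 0 <= c ->
  (forall i j, `|M i j| <= c) -> `|M| <= c.
Proof.
by move=> c0 H; rewrite [leLHS]/Num.Def.normr/= mx_normrE bigmax_le.
Qed.

End VectorCalculus.

(** * Inverse function theorem *)

Lemma contraction_fixed_point (R : realType) (X : completeNormedModType R)
    (U : set X) (f : X -> X) (q : R) :
  0 <= q < 1 -> {homo f : x / U x} ->
  (forall x y, U x -> U y -> `|f x - f y| <= q * `|x - y|) ->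
  closed U -> U !=set0 -> exists2 p, U p & f p = p.
Proof.
move=> /andP[q0 q1] fU ctr cU U0.
have fU' : {homo f : x / U x >-> U x} by [].
have [] := @banach_fixed_point R X U (mkfun fU') _ cU U0.
  exists (NngNum q0); split => //= -[x y] [/= Ux Uy]; exact: ctr.
by move=> p Up pE; exists p.
Qed.


(* The library has no canonical completeNormedModType structure on matrices. *)
Definition complete_rV (R : realType) (d : nat) : completeNormedModType R :=
  HB.pack 'rV[R]_d.

Lemma rV_fixed_point (R : realType) (d : nat) (U : set 'rV[R]_d)
    (f : 'rV[R]_d -> 'rV[R]_d) (q : R) :
  0 <= q < 1 -> {homo f : x / U x} ->
  (forall x y, U x -> U y -> `|f x - f y| <= q * `|x - y|) ->
  closed U -> U !=set0 -> exists2 p, U p & f p = p.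
Proof. exact: (@contraction_fixed_point R (complete_rV R d)). Qed.

Section InverseFunction.
Context {R : realType} {d : nat}.
Implicit Types (x y z v : 'rV[R]_d).

Lemma dnbhs0_scale_lt (c s : R) : 0 <= c -> 0 < s ->
  \forall h \near (0 : R)^', `|h| * c < s.
Proof.
move=> c0 s0; near=> h.
rewrite (@le_lt_trans _ _ (`|h| * (c + 1)))//.
  by rewrite ler_wpM2l// lerDl.
rewrite -ltr_pdivlMr ?ltr_wpDl//; near: h; apply: dnbhs0_lt.
by rewrite divr_gt0// ltr_wpDl.
Unshelve. all: by end_near. Qed.

Lemma continuous_dist (f : 'rV[R]_d -> R) x :
  (forall e, 0 < e -> \forall z \near x, `|f x - f z| < e) ->
  {for x, continuous f}.
Proof.
have : forall (F : set_system 'rV[R]_d), Filter F ->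
    (forall e, 0 < e -> \forall z \near F, `|f x - f z| < e) -> f @ F --> f x.
  by move=> F FF H; apply/cvgrPdist_lt.
by apply; exact: nbhs_filter.
Qed.

Lemma ball_rVE x (r : R) y : ball x r y <-> `|x - y| < r.
Proof. by rewrite -ball_normE. Qed.

(** With [jac th x0 = 1%:M], [th] differs from the identity by a 1/2-Lipschitz map near [x0]. This
    gives injectivity with a 2-Lipschitz inverse, and surjectivity onto a ball by a fixed point
    argument. *)
Lemma inverse_near_id (O : set 'rV[R]_d) x0 (th : 'rV[R]_d -> 'rV[R]_d) :
  open O -> smoothv O th -> O x0 -> jac th x0 = 1%:M ->
  exists (N : set 'rV[R]_d) (ps : 'rV[R]_d -> 'rV[R]_d) (rho : R),
  [/\ open N /\ N `<=` O, N x0, 0 < rho,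
      forall x, N x -> [/\ ball (th x0) rho (th x), ps (th x) = x
                         & jac th x \in unitmx] &
      (forall y, ball (th x0) rho y -> N (ps y) /\ th (ps y) = y) /\
      smoothv (ball (th x0) rho) ps].
Proof.
move=> oO sth Ox0 jac1.
have cdet : {for x0, continuous (fun x => \det (jac th x))}.
  apply: (@Ck_continuous _ _ O 0) => //; apply: Ck_det => // i j.
  rewrite (_ : (fun x => _) = partial i (fun y => th y 0 j)).
    by have [_ /(_ i)[]] := sth j 1%N.
  by apply/funext => x; rewrite mxE.
have : \forall x \near x0, jac th x \in unitmx.
  have := cdet; rewrite /prop_for /continuous_at jac1 det1.
  move=> /cvgrPdist_lt/(_ 1 ltr01); apply: filterS => x.
  rewrite unitmxE unitfE; apply: contraTneq => ->.
  by rewrite subr0 normr1 ltxx.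
move=> /nbhs_ballP[r1 /= r10 unitN].
(* Since [norm1] is at most [d] times the max norm, this yields the factor 1/2; the successor avoids
   dividing by zero. *)
pose eps : R := (2 * d.+1%:R)^-1.
have eps0 : 0 < eps by rewrite invr_gt0 mulr_gt0.
have [r2 r20 [r2O strict]] := smoothv_strict oO sth Ox0 eps0.
pose r := Num.min r1 r2.
have r0 : 0 < r by rewrite lt_min r10.
have rr1 : ball x0 r `<=` ball x0 r1 by apply: le_ball; rewrite ge_min lexx.
have rr2 : ball x0 r `<=` ball x0 r2.
  by apply: le_ball; rewrite ge_min lexx orbT.
have half x y : ball x0 r x -> ball x0 r y ->
    `|th x - th y - (x - y)| <= 2^-1 * `|x - y|.
  move=> /rr2 bx /rr2 by_; apply: mx_norm_le.
    by rewrite mulr_ge0 ?invr_ge0.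
  move=> i j; rewrite ord1; have := strict x y bx by_ j.
  rewrite jac1 mulmx1 => /le_trans; apply.
  have : eps * norm1 (x - y) <= eps * (d.+1%:R * `|x - y|).
    rewrite ler_pM2l// (le_trans (norm1_le_norm _))// ler_wpM2r//.
    by rewrite ler_nat.
  move=> /le_trans; apply.
  by rewrite mulrA /eps invfM divfK// lt0r_neq0.
have expand x y : ball x0 r x -> ball x0 r y -> `|x - y| <= 2 * `|th x - th y|.
  move=> bx by_; have := half x y bx by_.
  have : `|x - y| <= `|th x - th y| + `|th x - th y - (x - y)|.
    rewrite -[X in `|X| <= _](subKr (th x - th y)).
    by rewrite (le_trans (ler_normB _ _)).
  lra.
(* On the closed ball of radius [r / 2], [phi] moves points to distance at most
   [rho + r / 4 = r / 2] from [x0], hence maps that ball to itself. *)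
pose rho := r / 4.
have rho0 : 0 < rho by rewrite divr_gt0.
pose N := [set x | ball x0 r x /\ ball (th x0) rho (th x)].
have bx0 : ball x0 r x0 by exact: ballxx.
have surj y : ball (th x0) rho y -> exists x, N x /\ th x = y.
  move=> /[dup] byy /ball_rVE yr.
  pose U := [set x | `|x0 - x| <= r / 2].
  have UB x : U x -> ball x0 r x.
    move=> Ux; apply/ball_rVE; apply: le_lt_trans Ux _.
    by rewrite ltr_pdivrMr// ltr_pMr// ltr1n.
  (* Its fixed points are the solutions of [th x = y]. *)
  pose phi x := x + y - th x.
  have phiU : {homo phi : x / U x >-> U x}.
    move=> x Ux; have Bx := UB x Ux; rewrite /U/=.
    have -> : x0 - phi x = (th x0 - y) - (th x0 - th x - (x0 - x)).
      rewrite /phi; apply/rowP => i; rewrite !mxE; ring.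
    rewrite (le_trans (ler_normB _ _))//.
    have := half _ _ bx0 Bx; move: Ux yr; rewrite /U/= /rho; lra.
  have [||||p Up pE] := @rV_fixed_point R d U phi 2^-1 _ phiU.
  - by rewrite invr_ge0 ler0n/= invf_lt1// ltr1n.
  - move=> a b Ua Ub; rewrite distrC.
    have -> : phi b - phi a = th a - th b - (a - b).
      rewrite /phi; apply/rowP => i; rewrite !mxE; ring.
    exact: half (UB _ Ua) (UB _ Ub).
  - rewrite (_ : U = closed_ball x0 (r / 2)); first exact: closed_ball_closed.
    by rewrite closed_ballE ?divr_gt0.
  - by exists x0; rewrite /U/= subrr normr0 divr_ge0// ltW.
  exists p; have thp : th p = y.
    by move/rowP: pE => pE; apply/rowP => i; have := pE i; rewrite !mxE; lra.
  by split => //; split; [exact: UB|rewrite thp].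
pose ps y := xget x0 [set x | N x /\ th x = y].
have psP y : ball (th x0) rho y -> N (ps y) /\ th (ps y) = y.
  by move=> /surj; exact: xgetPex.
have oB : open (ball (th x0) rho) by exact: ball_open.
have thN x : N x -> ps (th x) = x.
  move=> [Bx tBx]; have [[Bp _] pE] := psP _ tBx.
  apply/eqP; rewrite -subr_eq0 -normr_le0 (le_trans (expand _ _ Bp Bx))//.
  by rewrite pE subrr normr0 mulr0.
have unitNx x : N x -> jac th x \in unitmx by move=> [/rr1 /unitN].
have NO x : N x -> O x by move=> [/rr2 /r2O].
have psL y y' : ball (th x0) rho y -> ball (th x0) rho y' ->
    `|ps y - ps y'| <= 2 * `|y - y'|.
  move=> /psP[[By _] yE] /psP[[By' _] y'E].
  by rewrite -{2}yE -{2}y'E; exact: expand.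
have oN : open N.
  rewrite openE => x [Bx tBx]; rewrite /interior.
  have n1 : nbhs x (ball x0 r).
    by apply: open_nbhs_nbhs; split => //; exact: ball_open.
  have n2 : nbhs (th x) (ball (th x0) rho) by exact: open_nbhs_nbhs.
  exact: (filterI n1 (smoothv_continuous sth (NO x (conj Bx tBx)) n2)).
(* With [x = ps y] and [xh = ps (h *: v + y)], the vector [h *: v - (xh - x) *m J] is the remainder
   of [th] at [x]. Multiplied by [invmx J] and divided by [h], it is the error of the difference
   quotient, and [psL] bounds [xh - x] by a multiple of [h]. *)
have dps y v j : ball (th x0) rho y ->
    is_derive y v (fun z => ps z 0 j) ((v *m invmx (jac th (ps y))) 0 j).
  move=> By; apply: cvg_is_derive; apply/cvgrPdist_le => e e0.
  have [Nx xE] := psP y By; set x := ps y in Nx xE *.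
  set J := jac th x; have uJ : J \in unitmx by exact: unitNx.
  (* Collects the factors met in the final estimate; adding 1 makes it positive. *)
  pose K : R := 2 * d%:R * `|v| * (\sum_i `|invmx J i j|) + 1.
  have K0 : 0 < K.
    by rewrite ltr_wpDl// mulr_ge0// ?sumr_ge0// mulr_ge0// mulr_ge0.
  have [s s0 [_ H]] := smoothv_strict oO sth (NO x Nx) (divr_gt0 e0 K0).
  have nB : \forall h \near (0 : R)^', ball (th x0) rho (h *: v + y).
    have [t /= t0 Ht] : nbhs_ball y (ball (th x0) rho).
      by rewrite nbhs_ballE; exact: open_nbhs_nbhs.
    apply: filterS (dnbhs0_scale_lt (normr_ge0 v) t0) => h hv.
    apply: Ht; apply/ball_rVE.
    by rewrite opprD addrCA subrr addr0 normrN normrZ.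
  have nS : \forall h \near (0 : R)^', 2 * (`|h| * `|v|) < s.
    have v2 : 0 <= 2 * `|v| by rewrite mulr_ge0.
    apply: filterS (dnbhs0_scale_lt v2 s0) => h.
    by rewrite mulrCA.
  near=> h.
  have h0 : h != 0 by near: h; exact: nbhs_dnbhs_neq.
  have Bh : ball (th x0) rho (h *: v + y) by near: h.
  have [Nh hE] := psP _ Bh; set xh := ps (h *: v + y) in Nh hE *.
  have dx : `|xh - x| <= 2 * (`|h| * `|v|).
    by rewrite -normrZ (le_trans (psL _ _ Bh By))// addrK.
  have Bxh : ball x s xh.
    by apply/ball_rVE; rewrite distrC (le_lt_trans dx)//; near: h.
  have {H} := H xh x Bxh (ballxx x s0).
  rewrite hE xE addrK -/J => H.
  have -> : (v *m invmx J) 0 j - h^-1 * (xh 0 j - x 0 j) =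
      h^-1 * \sum_i (h *: v - (xh - x) *m J) 0 i * invmx J i j.
    have -> : \sum_i (h *: v - (xh - x) *m J) 0 i * invmx J i j =
        ((h *: v - (xh - x) *m J) *m invmx J) 0 j by rewrite mxE.
    rewrite mulmxBl mulmxK// -scalemxAl; move: (v *m invmx J) => w.
    by rewrite !mxE [RHS]mulrBr mulKf.
  have : `|\sum_i (h *: v - (xh - x) *m J) 0 i * invmx J i j| <=
      e / K * norm1 (xh - x) * \sum_i `|invmx J i j|.
    rewrite mulr_sumr (le_trans (ler_norm_sum _ _ _))// ler_sum// => i _.
    by rewrite normrM ler_wpM2r.
  have : norm1 (xh - x) <= d%:R * (2 * (`|h| * `|v|)).
    by rewrite (le_trans (norm1_le_norm _))// ler_wpM2l.
  rewrite normrM normfV ler_pdivrMl ?normr_gt0// => H1 /le_trans; apply.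
  rewrite (@le_trans _ _ (e / K * (d%:R * (2 * (`|h| * `|v|))) *
     \sum_i `|invmx J i j|))//.
    rewrite ler_wpM2r ?sumr_ge0// ler_wpM2l// ltW// divr_gt0//.
  have -> : e / K * (d%:R * (2 * (`|h| * `|v|))) * \sum_i `|invmx J i j| =
      `|h| * e * ((K - 1) / K) by rewrite /K; ring.
  apply: ler_piMr; first by rewrite mulr_ge0// ltW.
  by rewrite ler_pdivrMr// mul1r gerBl.
(* Bootstrapping: the partial derivatives of [ps] are entries of the inverse of [jac th \o ps], so
   they are as regular as [ps] itself and each round gains one order. *)
have sps j k : Ck (ball (th x0) rho) k (fun z => ps z 0 j).
  elim: k j => [|k IH] j.
    move=> y By; apply: (continuous_dist (f := fun z => ps z 0 j)) => e e0.
    have nB : \forall z \near y, ball (th x0) rho z by exact: open_nbhs_nbhs.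
    have e20 : 0 < e / 2 by rewrite divr_gt0.
    apply: filter_app nB; apply/nbhs_ballP; exists (e / 2) => // z /= yz Bz.
    have : `|(ps y - ps z) 0 j| <= 2 * `|y - z|.
      exact: le_trans (coord_le_norm _ _) (psL _ _ By Bz).
    rewrite !mxE => /le_lt_trans; apply.
    by move: yz => /ball_rVE; lra.
  split; first by move=> y By; exact: Ck_continuous (IH j) By.
  move=> i; split=> [y By|].
    exact: (ex_derive (is_derive := dps y (delta_mx 0 i) j By)).
  apply: (@Ck_ext _ _ _ _ (fun y => invmx (jac th (ps y)) i j)) => //.
    move=> y By; rewrite /partial.
    by rewrite (derive_val (is_derive := dps y (delta_mx 0 i) j By)) -rowE mxE.
  apply: Ck_invmx => //; first by move=> y /psP[/unitNx].
  move=> a b; rewrite (_ : (fun y => _) = partial a (fun z => th z 0 b) \o ps).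
    2: by apply/funext => y; rewrite mxE.
  apply: (Ck_comp oB oO _ (fun j => IH j)); first by move=> y /psP[/NO].
  by have [_ /(_ a)[]] := sth b k.+1.
exists N, ps, rho; split.
- exact: (conj oN NO).
- exact: (conj bx0 (ballxx (th x0) rho0)).
- exact: rho0.
- by move=> x Nx; split; [exact: Nx.2|exact: thN|exact: unitNx].
- exact: (conj psP (fun j k => sps j k)).
Unshelve. all: by end_near. Qed.
End InverseFunction.

(** * Zero sets of maps of constant rank *)

Section ConstantRank.
Context {R : realType}.

Lemma jacD d e (O : set 'rV[R]_d) (f g : 'rV[R]_d -> 'rV[R]_e) x :
  open O -> smoothv O f -> smoothv O g -> O x ->
  jac (fun x => f x + g x) x = jac f x + jac g x.
Proof.
move=> oO sf sg Ox; apply/matrixP => i j; rewrite !mxE.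
rewrite (_ : (fun y => (f y + g y) 0 j) =
  (fun y => f y 0 j) + (fun y => g y 0 j)); last first.
  by apply/funext => y; rewrite mxE.
have df := ex_derive (is_derive := smoothv_derive (delta_mx 0 i) j oO sf Ox).
have dg := ex_derive (is_derive := smoothv_derive (delta_mx 0 i) j oO sg Ox).
exact: (deriveD df dg).
Qed.

Lemma jac_id d (x : 'rV[R]_d) : jac id x = 1%:M.
Proof.
rewrite (_ : id = mulmxr 1%:M); first exact: jac_linear.
by apply/funext => y /=; rewrite mulmx1.
Qed.

Lemma jac_ext d e (O : set 'rV[R]_d) (f g : 'rV[R]_d -> 'rV[R]_e) x :
  open O -> (forall y, O y -> f y = g y) -> O x -> jac f x = jac g x.
Proof.
move=> oO fg Ox; apply/matrixP => i j; rewrite !mxE.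
apply: near_eq_derive; apply: filterS (open_nbhs_nbhs (conj oO Ox)) => y Oy.
by rewrite fg.
Qed.

(** By rank-nullity, equality of the ranks means that the row space of [M] meets the kernel of [K]
    trivially. *)
Lemma mulmx_rank_inj (m n p q : nat) (M : 'M[R]_(m, n)) (K : 'M[R]_(n, p))
    (u : 'M[R]_(q, m)) :
  \rank (M *m K) = \rank M -> u *m M *m K = 0 -> u *m M = 0.
Proof.
move=> rMK uMK; apply/eqP; rewrite -submx0.
have /eqP : \rank (M :&: kermx K)%MS = 0%N.
  by apply/eqP; rewrite -(eqn_add2l (\rank (M *m K))) mxrank_mul_ker rMK addn0.
rewrite mxrank_eq0 => /eqP <-.
by rewrite sub_capmx submxMl; apply/sub_kermxP.
Qed.

(* [th = id + (G - A) B] with [A = jac G x0] and [B] a generalized inverse of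
   [A], so that [jac th x0 = 1] and [th x *m A = G x *m B *m A].  In the
   coordinates [th] the derivative of [G] has a kernel containing [ker A]:
   [w *m A = 0] reads [u *m jac G x *m (B A) = 0], where multiplication by [B A]
   does not decrease the rank of [jac G x]. *)
Lemma constant_rank_zeros d e (O : set 'rV[R]_d) (G : 'rV[R]_d -> 'rV[R]_e)
    (r : nat) x0 :
  open O -> smoothv O G -> (forall x, O x -> \rank (jac G x) = r) ->
  O x0 -> G x0 = 0 ->
  exists (N : set 'rV[R]_d) (th ps : 'rV[R]_d -> 'rV[R]_d) (y0 : 'rV[R]_d)
    (rho : R),
  [/\ [/\ open N, N `<=` O, N x0 & 0 < rho],
      smoothv N th /\ smoothv (ball y0 rho) ps,
      forall x, N x -> ball y0 rho (th x) /\ ps (th x) = x,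
      forall y, ball y0 rho y -> N (ps y) /\ th (ps y) = y &
      forall x, N x -> G x = 0 <-> th x *m jac G x0 = 0].
Proof.
move=> oO sG rG Ox0 G0; pose A := jac G x0; pose B := pinvmx A.
have ABA : A *m B *m A = A by rewrite mulmxKpV.
pose th x := x *m (1%:M - A *m B) + G x *m B.
have s1 (L : 'M[R]_d) : smoothv O (fun x => x *m L).
  exact: (smoothv_linear L oO (@smoothv_id _ _ O)).
have s2 : smoothv O (fun x => G x *m B) by exact: smoothv_linear.
have sth : smoothv O th by exact: smoothvD.
have jth x : O x -> jac th x = 1%:M - A *m B + jac G x *m B.
  move=> Ox; rewrite (jacD oO (s1 _) s2 Ox); congr (_ + _).
    exact: (jac_linear (1%:M - A *m B) x).
  have sB : smoothv setT (mulmxr B : 'rV[R]_e -> 'rV[R]_d).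
    exact: (smoothv_linear B openT (@smoothv_id _ _ setT)).
  by rewrite -[RHS](congr1 _ (jac_linear B (G x))) -(jac_comp oO openT sG sB).
have thA x : th x *m A = G x *m B *m A.
  rewrite /th mulmxDl -mulmxA mulmxBl mul1mx ABA subrr mulmx0 add0r.
  by [].
have j0 : jac th x0 = 1%:M by rewrite jth// subrK.
have [N [ps [rho [[oN NO] Nx0 rho0 thN [psB sps]]]]] :=
  inverse_near_id oO sth Ox0 j0.
have oB : open (ball (th x0) rho) by exact: ball_open.
exists N, th, ps, (th x0), rho; split => //.
- by split=> //; exact: smoothv_sub NO sth.
- by move=> x /thN[].
move=> x Nx; split=> [Gx|thx]; first by rewrite thA Gx !mul0mx.
pose w := th x - th x0.
have wA : w *m A = 0 by rewrite mulmxBl thx thA G0 !mul0mx subrr.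
have [Bx psx _] := thN x Nx.
have sGps : smoothv (ball (th x0) rho) (G \o ps).
  by apply: smoothv_comp oB oO _ sps sG => y /psB[/NO].
apply/rowP => j; rewrite mxE.
(* Mean value bound with constant 0 on the segment from [th x0] to [th x], which lies in the ball:
   [G \o ps] has zero derivative along [w] there. *)
suff : `|(G \o ps) (th x0 + 1 *: w) 0 j - (G \o ps) (th x0) 0 j| <= 0 * `|1|.
  rewrite mul0r normr_le0 subr_eq0 scale1r addrC subrK /= psx.
  by have [_ -> _] := thN x0 Nx0; rewrite G0 mxE => /eqP.
apply: (line_mean_value (f := fun y => (G \o ps) y 0 j)) => s.
rewrite mulr1 => /andP[s_ge0 s_le1].
have By : ball (th x0) rho (th x0 + s *: w).
  apply/ball_rVE; rewrite opprD addrA subrr sub0r normrN normrZ ger0_norm//.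
  apply: (@le_lt_trans _ _ `|w|); first by rewrite ler_piMl.
  by move/ball_rVE: Bx; rewrite distrC.
set y := th x0 + s *: w in By *.
have dy := smoothv_derive w j oB sGps By.
split; first exact: (ex_derive (is_derive := dy)).
rewrite (derive_val (is_derive := dy)).
have [Np thp] := psB y By; have [_ _ uT] := thN _ Np; have Op := NO _ Np.
rewrite (jac_comp oB oO sps sG By Op) mulmxA.
set u := w *m jac ps y; set A' := jac G (ps y).
have uTw : u *m jac th (ps y) = w.
  rewrite -mulmxA -(jac_comp oB oO sps sth By Op).
  rewrite (@jac_ext _ _ _ _ id _ oB _ By) ?jac_id ?mulmx1// => z Bz.
  by have [] := psB z Bz.
have TA : jac th (ps y) *m A = A' *m (B *m A).
  by rewrite (jth _ Op) mulmxDl mulmxBl mul1mx ABA subrr add0r -mulmxA.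
suff -> : u *m A' = 0 by rewrite mxE normr0.
(* By [TA], [A' *m (B *m A)] is an invertible matrix times [A], so its rank is that of [A], which is
   [r], as is the rank of [A']. This is where constancy of the rank enters. *)
apply: (@mulmx_rank_inj _ _ _ _ _ (B *m A)).
  rewrite -TA (eqmxMfull _ _) ?row_full_unit// /A' (rG _ Op); exact: rG Ox0.
by rewrite -mulmxA -TA mulmxA uTw.
Qed.

End ConstantRank.

(** * Null sets *)

Section NullSets.
Context {R : realType} {d : nat}.
Implicit Types (A E : set 'rV[R]_d) (p : 'rV[R]_d * 'rV[R]_d).

Definition box p : set 'rV[R]_d :=
  [set x | forall j, p.1 0 j <= x 0 j <= p.2 0 j].

Definition box_volume p : R := \prod_(j < d) (p.2 0 j - p.1 0 j).

(** Jordan content zero. Covers are finite here; countable unions of such sets then give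
    [null_set]. *)
Definition content_zero A := forall e : R, 0 < e ->
  exists s : seq ('rV[R]_d * 'rV[R]_d),
  [/\ forall p, p \in s -> forall j, p.1 0 j <= p.2 0 j,
      forall x, A x -> exists2 p, p \in s & box p x &
      \sum_(p <- s) box_volume p < e].

Lemma content_zero_sub A E : A `<=` E -> content_zero E -> content_zero A.
Proof.
move=> AE E0 e /E0[s [sle sE sv]]; exists s; split => //.
by move=> x /AE; exact: sE.
Qed.

Lemma content_zero0 : content_zero set0.
Proof. by move=> e e0; exists [::]; split => //; rewrite big_nil. Qed.

Lemma null_set_sub A E : A `<=` E -> Defs.null_set E -> Defs.null_set A.
Proof.
move=> AE E0 e /E0[D [a [b [ab Eab v]]]]; exists D, a, b; split => //.
exact: subset_trans AE Eab.
Qed.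

Lemma box_volume_ge0 p : (forall j, p.1 0 j <= p.2 0 j) -> 0 <= box_volume p.
Proof. by move=> H; apply: prodr_ge0 => j _; rewrite subr_ge0. Qed.

Lemma null_set_bigcup (A : nat -> set 'rV[R]_d) :
  (forall n, content_zero (A n)) -> Defs.null_set (\bigcup_n A n).
Proof.
move=> A0 e e0.
(* The budgets add up to [e / 2]: summing only gives a weak inequality, while the total must stay
   strictly below [e]. *)
have e2 n : 0 < e / 2 / (2 ^ n.+1)%:R.
  by rewrite !divr_gt0// ltr0n expn_gt0.
have [s Hs] := choice (fun n => A0 n _ (e2 n)).
pose g (k : nat) : nat * nat := odflt (0, 0)%N (unpickle k).
(* Pairs of a list number and a valid position in that list, so the default boxes of [nth] are never
   counted. *)
pose P := [set: nat] `*`` (fun n => `I_(size (s n))).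
pose q (u : nat * nat) := nth (0, 0) (s u.1) u.2.
have gK u : g (pickle u) = u by rewrite /g pickleK.
have qs u : P u -> q u \in s u.1 by move=> [_ /= ?]; exact: mem_nth.
have qle u : P u -> forall j, (q u).1 0 j <= (q u).2 0 j.
  by move=> Pu; have [H _ _] := Hs u.1; exact: H (qs u Pu).
exists (pickle @` P), (fun k => (q (g k)).1), (fun k => (q (g k)).2); split.
- by move=> _ [u Pu <-]; rewrite gK; exact: qle.
- move=> x [n _ Anx]; have [_ /(_ x Anx)[p ps px] _] := Hs n.
  have Pu : P (n, index p (s n)) by split => //=; rewrite index_mem.
  exists (pickle (n, index p (s n))); first by exists (n, index p (s n)).
  by rewrite gK /q /= nth_index.
rewrite esum_image; last by move=> u v _ _ /(pcan_inj pickleK).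
under eq_esum do rewrite gK.
rewrite -(@esum_esum _ _ _ setT (fun n => `I_(size (s n)))
  (fun n i => (box_volume (q (n, i)))%:E)); last first.
  by move=> n i _ si; rewrite lee_fin; apply/box_volume_ge0/qle; split.
apply: (@le_lt_trans _ _ (e / 2)%:E); last first.
  by rewrite lte_fin ltr_pdivrMr// ltr_pMr// ltr1n.
apply: (@le_trans _ _ (\esum_(n in [set: nat]) (e / 2 / (2 ^ n.+1)%:R)%:E)%E).
  apply: le_esum => n _; rewrite esum_fset//; last first.
    move=> i; rewrite inE => si.
    by rewrite lee_fin; apply/box_volume_ge0/qle; split.
  rewrite -fsbig_ord sumEFin lee_fin; have [_ _ /ltW] := Hs n.
  by rewrite (big_nth (0, 0)) big_mkord.
rewrite -nneseries_esumT; last by move=> n; rewrite lee_fin ltW.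
by apply: epsilon_trick0; rewrite divr_ge0// ltW.
Qed.

(** Lindelöf argument: balls with rational centres and radii [1 / (n + 1)] are countably many, and
    those meeting [E] in content zero already cover it. *)
Lemma null_set_local E :
  (forall y, E y -> exists2 r : R, 0 < r & content_zero (ball y r `&` E)) ->
  Defs.null_set E.
Proof.
move=> locE.
pose B (u : 'rV[rat]_d * nat) : set 'rV[R]_d :=
  ball (map_mx ratr u.1 : 'rV[R]_d) (u.2.+1%:R^-1 : R) `&` E.
pose A k := if unpickle k is Some u then
  (if `[< content_zero (B u) >] then B u else set0) else set0.
apply: (@null_set_sub _ (\bigcup_k A k)); last first.
  apply: null_set_bigcup => k; rewrite /A.
  case: (unpickle k) => [u|]; last exact: content_zero0.
  by case: asboolP => // _; exact: content_zero0.
move=> y Ey; have [r r0 Er] := locE y Ey.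
(* Makes the radius [t] at most [r / 2], so a ball of radius [t] containing [y] lies inside
   [ball y r]. *)
pose n := Num.truncn (2 / r).
pose t : R := n.+1%:R^-1.
have t0 : 0 < t by rewrite invr_gt0.
have tr : t + t <= r.
  have : 2 / r < n.+1%:R by exact: truncnS_gt.
  rewrite ltr_pdivrMr// => H.
  by rewrite -mulr2n -mulr_natl /t ler_pdivrMr// mulrC ltW.
have /choice[f Hf] : forall j : 'I_d, exists q : rat, `|ratr q - y 0 j| < t.
  move=> j; have [|q] := @rat_in_itvoo R (y 0 j - t) (y 0 j + t).
    by rewrite ltrD2l gtrN.
  by rewrite in_itv/= => Hq; exists q; rewrite ltr_norml; lra.
pose q : 'rV[rat]_d := \row_j f j.
have yq : ball (map_mx ratr q : 'rV[R]_d) t y.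
  by apply/rV_ballP => // j; rewrite !mxE.
have Bq : content_zero (B (q, n)).
  apply: content_zero_sub Er => z [qz Ez]; split => //.
  by apply: (le_ball tr); apply: ball_triangle qz; exact: ball_sym.
by exists (pickle (q, n)) => //; rewrite /A pickleK; case: asboolP.
Qed.

Lemma grid_cell (h t : R) (N : nat) : 0 <= t <= h *+ N.+1 ->
  exists i : 'I_N.+1, h *+ i <= t <= h *+ i + h.
Proof.
elim: N => [|N IH] /andP[t0 tN].
  by exists ord0; rewrite mulr0n t0 add0r.
have [tle|tgt] := leP t (h *+ N.+1).
  have [|i Hi] := IH; first by rewrite t0.
  by exists (widen_ord (leqnSn _) i).
by exists ord_max; rewrite (ltW tgt)/= -mulrSr.
Qed.

(** Cut the coordinates other than [j0] into cells of side [h]. Over one cell two points of [E]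
    differ by at most [L * h] in coordinate [j0], so a box of height [2 * L * h] suffices there, and
    the total volume is [C * h]. *)
Lemma cone_content_zero E (c : 'rV[R]_d) (r L : R) (j0 : 'I_d) :
  0 < r -> 0 <= L ->
  (forall x, E x -> forall k, `|c 0 k - x 0 k| <= r) ->
  (forall x y s, E x -> E y -> (forall k, k != j0 -> `|x 0 k - y 0 k| <= s) ->
     0 <= s -> `|x 0 j0 - y 0 j0| <= L * s) ->
  content_zero E.
Proof.
move=> r0 L0 Er cone e e0.
pose C : R := 2 * L * \prod_(k < d | k != j0) (2 * r).
have C0 : 0 <= C.
  by rewrite !mulr_ge0// prodr_ge0// => k _; rewrite mulr_ge0// ltW.
pose N := Num.truncn (C * (2 * r) / e).
pose h : R := 2 * r / N.+1%:R.
have h0 : 0 < h by rewrite divr_gt0// mulr_gt0.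
have hN : h *+ N.+1 = 2 * r by rewrite -[LHS]mulr_natr /h divfK// pnatr_eq0.
have Ch : C * h < e.
  have : C * (2 * r) / e < N.+1%:R by exact: truncnS_gt.
  by rewrite ltr_pdivrMr// => CN; rewrite /h mulrA ltr_pdivrMr// [ltRHS]mulrC.
pose lo (q : {ffun 'I_d -> 'I_N.+1}) k := c 0 k - r + h *+ q k.
pose cell q :=
  [set x | E x /\ forall k, k != j0 -> lo q k <= x 0 k <= lo q k + h].
pose w k (i : 'I_N.+1) : R :=
  if k == j0 then (if i == ord0 then 2 * L * h else 0) else h.
(* In direction [j0] the box is centred at a chosen point of [E] over the cell. If there is none,
   the default [c] is harmless. *)
pose a q : 'rV[R]_d := \row_k (if k == j0 then
  (xget c (cell q)) 0 j0 - w j0 (q j0) / 2 else lo q k).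
pose b q : 'rV[R]_d := \row_k (a q 0 k + w k (q k)).
have bE q k : b q 0 k = a q 0 k + w k (q k) by rewrite mxE.
have aE q k : a q 0 k = if k == j0 then
  (xget c (cell q)) 0 j0 - w j0 (q j0) / 2 else lo q k by rewrite mxE.
have w0 k i : 0 <= w k i.
  rewrite /w; case: ifP => _; last exact: ltW.
  by case: ifP => // _; rewrite !mulr_ge0// ltW.
exists [seq (a q, b q) | q <- enum {ffun 'I_d -> 'I_N.+1}]; split.
- by move=> _ /mapP[q _ ->] j /=; rewrite bE lerDl.
- move=> x Ex.
  have /choice[f Hf] : forall k : 'I_d, exists i : 'I_N.+1,
      if k == j0 then i = ord0 else
      c 0 k - r + h *+ i <= x 0 k <= c 0 k - r + h *+ i + h.
    move=> k; case: eqP => [_|_]; first by exists ord0.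
    have [|i Hi] := @grid_cell h (x 0 k - (c 0 k - r)) N.
      by rewrite hN; have := Er x Ex k; rewrite ler_norml; lra.
    by exists i; move: Hi; lra.
  pose q : {ffun 'I_d -> 'I_N.+1} := [ffun k => f k].
  have qx : cell q x.
    split=> // k kj; have := Hf k; rewrite (negPf kj) /lo /q ffunE.
    exact.
  exists (a q, b q); first by apply: map_f; rewrite mem_enum.
  move=> k; rewrite /= bE aE.
  have [->|kj] := eqVneq k j0; last first.
    by have [_ /(_ k kj)] := qx; rewrite /w (negPf kj).
  have [Ez zq] : cell q (xget c (cell q)) by apply: xgetPex; exists x.
  set z := xget _ _ in Ez zq *.
  have : `|x 0 j0 - z 0 j0| <= L * h.
    apply: cone => //; last exact: ltW.
    move=> l lj; have [_ /(_ l lj)] := qx; have := zq l lj.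
    by rewrite ler_norml; lra.
  have -> : w j0 (q j0) = 2 * (L * h).
    rewrite /w eqxx /q ffunE; have := Hf j0; rewrite eqxx => ->.
    by rewrite eqxx mulrA.
  by rewrite ler_norml; lra.
rewrite big_map big_enum/=.
rewrite (eq_bigr
  (fun q : {ffun 'I_d -> 'I_N.+1} => \prod_k w k (q k))); last first.
  by move=> q _; apply: eq_bigr => k _ /=; rewrite bE addrAC subrr add0r.
rewrite -(bigA_distr_bigA w) (bigD1 j0)//=.
rewrite (bigD1 ord0)//= {1}/w !eqxx big1 ?addr0; last first.
  by move=> i /negPf i0; rewrite /w eqxx i0.
rewrite (eq_bigr (fun=> 2 * r)); first by rewrite mulrAC.
move=> k /negPf kj; rewrite /w kj sumr_const card_ord; exact: hN.
Qed.

(** Between two zeros, strict differentiability with constant [|c| / 2] bounds [|c|] times the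
    difference in coordinate [j0] by half of itself plus a multiple of the other differences.
    Absorbing that half gives the cone condition. *)
Lemma zeros_content_zero (O : set 'rV[R]_d) (g : 'rV[R]_d -> R) y j0 :
  open O -> Ck O 1 g -> O y -> partial j0 g y != 0 ->
  exists2 r : R, 0 < r & content_zero (ball y r `&` [set x | g x = 0]).
Proof.
move=> oO Cg Oy; set c := partial j0 g y => c0.
have e0 : 0 < `|c| / 2 by rewrite divr_gt0// normr_gt0.
have [r r0 H] := C1_strict oO Cg Oy e0; exists r => //.
pose D : R := \sum_i `|partial i g y|.
have D0 : 0 <= D by rewrite sumr_ge0.
apply: (@cone_content_zero _ y r ((D + `|c| / 2 * d%:R) / (`|c| / 2)) j0) => //.
- by rewrite divr_ge0 ?addr_ge0// ?mulr_ge0// ltW.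
- by move=> x [/rV_ballP-/(_ r0) Hx _] k; rewrite ltW.
move=> x z s [Bx gx] [Bz gz] xz s0; have {H} := H x z Bx Bz.
rewrite gx gz subrr sub0r normrN => H.
rewrite mulrAC ler_pdivlMr//.
have sb k : k != j0 -> `|(x - z) 0 k| <= s by move=> /xz; rewrite !mxE.
have n1 : norm1 (x - z) <= `|x 0 j0 - z 0 j0| + d%:R * s.
  rewrite /norm1 (bigD1 j0)//= !mxE lerD2l.
  rewrite (@le_trans _ _ (\sum_(k < d | k != j0) s)) ?ler_sum//.
  rewrite sumr_const mulr_natl ler_wpMn2l// (leq_trans (max_card _))//.
  by rewrite card_ord.
have rest : `|\sum_(k < d | k != j0) (x - z) 0 k * partial k g y| <= D * s.
  rewrite (le_trans (ler_norm_sum _ _ _))//.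
  rewrite (@le_trans _ _ (\sum_(k < d | k != j0) s * `|partial k g y|))//.
    by apply: ler_sum => k kj; rewrite normrM ler_wpM2r// sb.
  rewrite -mulr_sumr mulrC ler_wpM2r// /D [leRHS](bigD1 j0)//=.
  by rewrite lerDr.
have tc : `|x 0 j0 - z 0 j0| * `|c| <= `|c| / 2 * norm1 (x - z) + D * s.
  rewrite -normrM.
  have -> : (x 0 j0 - z 0 j0) * c = \sum_i (x - z) 0 i * partial i g y -
      \sum_(k < d | k != j0) (x - z) 0 k * partial k g y.
    by rewrite [in RHS](bigD1 j0)//= !mxE addrK.
  by rewrite (le_trans (ler_normB _ _))// lerD.
have : `|c| / 2 * norm1 (x - z) <= `|c| / 2 * (`|x 0 j0 - z 0 j0| + d%:R * s).
  by rewrite ler_pM2l.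
move: tc; set t := `|x 0 j0 - z 0 j0|; set cc := `|c|; set n := norm1 _; lra.
Qed.

End NullSets.

(** * Comparison with directional derivatives along a subspace *)

Import VectorInternalTheory.

Section Bridge.
Context {R : realType}.

Lemma Ck_on_Ck d p q (O : set 'rV[R]_d) k (f : 'rV[R]_d -> 'M[R]_(p, q)) i j :
  open O -> Ck_on fullv O k f -> Ck O k (fun x => f x i j).
Proof.
move=> oO; have cont (g : 'rV[R]_d -> 'M[R]_(p, q)) :
    {within O, continuous g} ->
    forall x, O x -> {for x, continuous (fun x => g x i j)}.
  rewrite continuous_open_subspace// => cg x Ox.
  apply: (@continuous_comp _ _ _ g (fun A : 'M[R]_(p, q) => A i j)).
    by apply: cg; rewrite inE.
  exact: coord_continuous.
elim: k f => [|k IH] f; first exact: cont.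
move=> [cf df]; split; first exact: cont.
move=> l; have [dfl Dfl] := df (delta_mx 0 l) (memvf _); split.
  by move=> x Ox; exact: (derivable_mxP f x (delta_mx 0 l)).1 (dfl x Ox) i j.
apply: Ck_ext oO _ (IH _ Dfl) => x Ox.
by rewrite derive_mx ?mxE//; exact: dfl.
Qed.

(** All orders are assumed at once so that the induction can pass to ['D_V f], whose entries are
    fixed linear combinations of partial derivatives. *)
Lemma smooth_on_fullv d p q (O : set 'rV[R]_d) (f : 'rV[R]_d -> 'M[R]_(p, q)) :
  open O -> (forall i j k, Ck O k (fun x => f x i j)) -> smooth_on fullv O f.
Proof.
move=> oO sf k; have cont (g : 'rV[R]_d -> 'M[R]_(p, q)) :
    (forall i j k, Ck O k (fun x => g x i j)) -> {within O, continuous g}.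
  rewrite continuous_open_subspace// => cg x; rewrite inE => Ox.
  apply: (@mx_cvg _ _ _ _ _ (nbhs_filter x) g (g x)) => i j.
  exact: (cg i j 0%N).
elim: k f sf => [|k IH] f sf; first exact: cont.
split; first exact: cont.
move=> V _; have dV x : O x -> derivable f x V.
  move=> Ox; apply/derivable_mxP => i j.
  exact: (ex_derive (is_derive := C1_derive V oO (sf i j 1%N) Ox)).
split=> //; apply: IH => i j l.
apply: (@Ck_ext _ _ _ _
  (fun x => \sum_a V 0 a * partial a (fun x => f x i j) x)).
- exact: oO.
- move=> x Ox; rewrite derive_mx ?mxE; last exact: dV.
  by rewrite (derive_val (is_derive := C1_derive V oO (sf i j 1%N) Ox)).
- apply: Ck_sum => // a _; apply: CkM => //; first exact: Ck_cst.
  by have [_ /(_ a)[]] := sf i j l.+1.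
Qed.

(** An equality of functions without any differentiability assumption: the difference quotients
    coincide. *)
Lemma derive_affine_comp (V V' W : normedModType R) (L l : V -> V')
    (g : V' -> W) v :
  (forall h v x, L (h *: v + x) = h *: l v + L x) ->
  'D_v (g \o L) = 'D_(l v) g \o L.
Proof.
move=> affL; apply/funext => x; rewrite /derive /=.
rewrite (_ : (fun h : R => _) =
    fun h => h^-1 *: (g (h *: l v + L x) - g (L x)))//.
by apply/funext => h; rewrite affL.
Qed.

(** Serves both the parametrization [par] and its inverse [cor]. *)
Lemma Ck_on_affine_comp p q p' q' p2 q2 (T : {vspace 'M[R]_(p, q)})
    (T' : {vspace 'M[R]_(p', q')}) (U : set 'M[R]_(p, q))
    (U' : set 'M[R]_(p', q')) (L l : 'M[R]_(p, q) -> 'M[R]_(p', q')) k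
    (g : 'M[R]_(p', q') -> 'M[R]_(p2, q2)) :
  (forall h v x, L (h *: v + x) = h *: l v + L x) ->
  (forall v, v \in T -> l v \in T') -> continuous L ->
  (forall x, U x -> U' (L x)) -> Ck_on T' U' k g -> Ck_on T U k (g \o L).
Proof.
move=> affL lT cL LU; have cont (f : 'M[R]_(p', q') -> 'M[R]_(p2, q2)) :
    {within U', continuous f} -> {within U, continuous (f \o L)}.
  move=> /subspace_continuousP cf; apply/subspace_continuousP => x Ux.
  apply: cvg_comp; last exact: (cf _ (LU _ Ux)).
  move=> A HA; apply: (@filterS _ (nbhs x) (nbhs_filter x) _ _ _ (cL x _ HA)).
  by move=> z /= Hz /LU; exact: Hz.
elim: k g => [|k IH] g; first exact: cont.
move=> [cg dg]; split; first exact: cont.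
move=> V /lT lV; have [dgl Dgl] := dg _ lV; split; last first.
  by rewrite (derive_affine_comp _ _ affL); exact: IH.
move=> x /LU LUx; have := dgl _ LUx; rewrite /derivable /=.
rewrite [X in _ -> cvg (X @ _)](_ : _ =
    fun h => h^-1 *: (g (h *: l V + L x) - g (L x)))//.
by apply/funext => h /=; rewrite affL.
Qed.

Lemma linear_mx_continuous p q p' q'
    (l : {linear 'M[R]_(p, q) -> 'M[R]_(p', q')}) : continuous l.
Proof.
move=> X; apply: (@mx_cvg _ _ _ _ _ (nbhs_filter X) l (l X)) => i j.
pose S (Y : 'M[R]_(p, q)) := \sum_a \sum_b Y a b * l (delta_mx a b) i j.
have E : (fun Y => l Y i j) = S.
  apply/funext => Y; rewrite /S.
  rewrite [in LHS](matrix_sum_delta Y) linear_sum summxE; apply: eq_bigr => a _.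
  rewrite linear_sum summxE; apply: eq_bigr => b _.
  by rewrite linearZ mxE.
change ((fun Y => l Y i j) @ nbhs X --> (fun Y => l Y i j) X); rewrite E.
apply: (@cvg_sumr R _ _ _ _ _ _ _ (nbhs_filter X)) => a _.
apply: (@cvg_sumr R _ _ _ _ _ _ _ (nbhs_filter X)) => b _.
by apply: cvgMl; exact: coord_continuous.
Qed.

Lemma Ck_linear_mx d p q p' q' (O : set 'rV[R]_d)
    (l : {linear 'M[R]_(p, q) -> 'M[R]_(p', q')})
    (f : 'rV[R]_d -> 'M[R]_(p, q)) k i j :
  open O -> (forall i j, Ck O k (fun x => f x i j)) ->
  Ck O k (fun x => l (f x) i j).
Proof.
move=> oO sf.
rewrite (_ : (fun x => _) =
    fun x => \sum_a \sum_b f x a b * l (delta_mx a b) i j).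
  apply: Ck_sum => // a _; apply: Ck_sum => // b _; apply: CkM => //.
  exact: Ck_cst.
apply/funext => x.
rewrite [in LHS](matrix_sum_delta (f x)) linear_sum summxE.
apply: eq_bigr => a _.
by rewrite linear_sum summxE; apply: eq_bigr => b _; rewrite linearZ mxE.
Qed.

Lemma derive_linear_mx (V : normedModType R) p q p' q'
    (l : {linear 'M[R]_(p, q) -> 'M[R]_(p', q')}) (f : V -> 'M[R]_(p, q)) x v :
  derivable f x v -> 'D_v (l \o f) x = l ('D_v f x).
Proof.
move=> df; apply: cvg_lim => //.
have := cvg_comp _ _ df (@linear_mx_continuous _ _ _ _ l _).
apply: cvg_trans; rewrite (_ : (fun h : R => _) = l \o (fun h : R =>
   h^-1 *: ((f \o shift x) (h *: v) - f x)))//.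
apply/funext => h /=; rewrite [RHS]linearZ; congr (_ *: _).
by rewrite [RHS]linearB.
Qed.

Lemma dim_limg (aT rT : vectType R) (f : 'Hom(aT, rT)) :
  \dim (limg f) = \rank (f2mx f).
Proof.
rewrite unlock /dimv mx2vsK -[in RHS](mul1mx (f2mx f)).
by apply: eqmx_rank; apply/eqmxP/eqmxMr; exact: mx2vsK.
Qed.

(** In the basis [col_ebase A] the kernel is the vanishing of the first [\rank A] coordinates;
    reversing the order makes them the last ones, as the slices in [embedded_submanifold]
    require. *)
Lemma kernel_slice d e (A : 'M[R]_(d, e)) :
  exists2 Q : 'M[R]_d, Q \in unitmx & forall y : 'rV[R]_d,
    y *m A = 0 <-> forall j : 'I_d, (d - \rank A <= j)%N -> (y *m Q) 0 j = 0.
Proof.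
pose s := perm (@rev_ord_inj d); exists (col_perm s (col_ebase A)).
  by rewrite col_permE unitmx_mul col_ebase_unit unitmx_perm.
move=> y; have yQ j : (y *m col_perm s (col_ebase A)) 0 j =
    (y *m col_ebase A) 0 (rev_ord j).
  by rewrite !mxE; apply: eq_bigr => i _; rewrite !mxE permE.
have -> : y *m A = 0 <-> y *m col_ebase A *m pid_mx (\rank A) = 0 :> 'rV_e.
  rewrite -{1}(mulmx_ebase A) !mulmxA; split=> [|->]; last by rewrite mul0mx.
  move=> /(congr1 (mulmxr (invmx (row_ebase A)))) /=.
  by rewrite mul0mx mulmxK ?row_ebase_unit.
have rd := rank_leq_row A; have re := rank_leq_col A.
move: (y *m col_ebase A) yQ => z yQ; split=> [zp j jr|zQ].
  have jr' : (rev_ord j < \rank A)%N.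
    by rewrite /= subnSK// leq_subLR addnC -leq_subLR.
  have /rowP/(_ (Ordinal (leq_trans jr' re))) := zp.
  rewrite yQ !mxE (bigD1 (rev_ord j))//= [pid_mx _ _ _]mxE eqxx jr' mulr1.
  rewrite big1 ?addr0// => i; rewrite [pid_mx _ _ _]mxE -(inj_eq val_inj).
  by move=> /negPf ->; rewrite mulr0.
apply/rowP => j; rewrite !mxE big1// => i _; rewrite [pid_mx _ _ _]mxE.
case ir : (i < \rank A)%N; last by rewrite andbF mulr0.
have := zQ (rev_ord i); rewrite yQ rev_ordK => ->; first by rewrite mul0r.
by rewrite /= leq_sub2l.
Qed.

End Bridge.

(** * Level sets in an open subset of an affine subspace *)

Lemma jac_cst (R : realType) d e (c : 'rV[R]_e) (x : 'rV[R]_d) :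
  jac (cst c) x = 0.
Proof.
apply/matrixP => i j; rewrite !mxE.
exact: (derive_cst (c 0 j) x (delta_mx 0 i)).
Qed.

(** * Linear coordinates on a subspace *)

Section SubspaceCoordinates.
Context {R : realType} {p q : nat} (T : {vspace 'M[R]_(p, q)}).

Definition dir (x : 'rV[R]_(\dim T)) : 'M[R]_(p, q) :=
  vsval (@r2v R (subvs_of T) x).

(** Extended to all matrices by a projection onto [T], hence linear and continuous on the whole
    space. *)
Definition codir (X : 'M[R]_(p, q)) : 'rV[R]_(\dim T) := v2r (vsproj T X).

Lemma dir_is_linear : linear dir.
Proof. by move=> h x y; rewrite /dir !linearP. Qed.
HB.instance Definition _ := GRing.isSemilinear.Build R 'rV[R]_(\dim T)
  'M[R]_(p, q) _ dir (GRing.semilinear_linear dir_is_linear).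

Lemma codir_is_linear : linear codir.
Proof. by move=> h X Y; rewrite /codir !linearP. Qed.
HB.instance Definition _ := GRing.isSemilinear.Build R 'M[R]_(p, q)
  'rV[R]_(\dim T) _ codir (GRing.semilinear_linear codir_is_linear).

Lemma dir_mem x : dir x \in T.
Proof. exact: subvsP. Qed.

Lemma dirK : cancel dir codir.
Proof. by move=> x; rewrite /codir /dir vsvalK r2vK. Qed.

Lemma codirK : {in T, cancel codir dir}.
Proof. by move=> X XT; rewrite /codir /dir v2rK vsprojK. Qed.

End SubspaceCoordinates.

Section LevelSet.
Context {R : realType} {p q p1 q1 p2 q2 : nat}.
Variables (M : set 'M[R]_(p, q)) (T : {vspace 'M[R]_(p, q)}).
Variables (X0 : 'M[R]_(p, q)).
Variables (F : 'M[R]_(p, q) -> 'M[R]_(p1, q1)).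
Variables (l : {linear 'M[R]_(p1, q1) -> 'M[R]_(p2, q2)}) (r : nat).

Let par (x : 'rV[R]_(\dim T)) := X0 + dir x.
Let cor (X : 'M[R]_(p, q)) := codir T (X - X0).
Let O := par @^-1` M.
Let S := M `&` [set X | l (F X) = 0].

Hypothesis M_affine : forall X, M X -> X - X0 \in T.
Hypothesis open_O : open O.
Hypothesis smooth_F : smooth_on T M F.
Hypothesis rank_F : forall X, M X -> rank_differential T (l \o F) X = r.
Hypothesis r_gt0 : (0 < r)%N.

Let parK x : cor (par x) = x.
Proof. by rewrite /cor /par addrC addKr dirK. Qed.

Let corK X : M X -> par (cor X) = X.
Proof.
by move=> /M_affine XT; rewrite /par /cor codirK// addrC subrK.
Qed.

Let par_aff h v x : par (h *: v + x) = h *: dir v + par x.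
Proof. by rewrite /par linearP addrCA. Qed.

Let cor_aff h v x : cor (h *: v + x) = h *: codir T v + cor x.
Proof. by rewrite /cor -addrA linearP. Qed.

Let par_cts : continuous par.
Proof.
move=> x; apply: (@cvgD _ _ _ _ (nbhs_filter x)); first exact: cst_continuous.
exact: linear_mx_continuous.
Qed.

Let cor_cts : continuous cor.
Proof.
have sub_cts : continuous (fun X : 'M[R]_(p, q) => X - X0).
  move=> X; apply: (@cvgB _ _ _ _ (nbhs_filter X)); last exact: cst_continuous.
  exact: cvg_id.
by move=> X; apply: (continuous_comp (sub_cts X)); exact: linear_mx_continuous.
Qed.

Let G (x : 'rV[R]_(\dim T)) : 'rV[R]_(dim 'M[R]_(p2, q2)) :=
  v2r (l (F (par x))).

Let G0 x : G x = 0 <-> l (F (par x)) = 0.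
Proof.
by split=> [E|E]; [rewrite -[LHS]v2rK -/(G x) E linear0|rewrite /G E linear0].
Qed.

Let smooth_Fpar i j k : Ck O k (fun x => F (par x) i j).
Proof.
apply: Ck_on_Ck open_O _.
apply: (Ck_on_affine_comp par_aff (fun v _ => dir_mem v) par_cts) (smooth_F k).
by [].
Qed.

Let smooth_G : smoothv O G.
Proof.
move=> j k.
exact: (@Ck_linear_mx _ _ _ _ _ _ _ (v2r \o l) (F \o par)).
Qed.

(** The two matrices are equal: [f2mx] records the differential in the bases given by [r2v] and
    [v2r], the ones used by [dir] and [G]. *)
Let rank_G x : O x -> \rank (jac G x) = r.
Proof.
move=> Ox; rewrite -(rank_F Ox) /rank_differential dim_limg.
congr (\rank _); rewrite /differential unlock /=.
apply/matrixP => i j; rewrite [LHS]mxE [RHS]mxE /=.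
have [_ /(_ _ (dir_mem (delta_mx 0 i)))[/(_ _ Ox) dF _]] := smooth_F 1%N.
have dFpar : derivable (F \o par) x (delta_mx 0 i).
  apply/derivable_mxP => a b; have [_ /(_ i)[H _]] := smooth_Fpar a b 1%N.
  exact: H.
have dG : derivable G x (delta_mx 0 i).
  apply/derivable_mxP => a b; rewrite ord1.
  by have [_ /(_ i)[H _]] := smooth_G b 1%N; exact: H.
have -> : partial i (fun y => G y 0 j) x = 'D_(delta_mx 0 i) G x 0 j.
  by rewrite derive_mx// mxE.
rewrite (@derive_linear_mx _ _ _ _ _ _ (v2r \o l) (F \o par))//.
have /= -> := congr1 (@^~ x) (derive_affine_comp F (delta_mx 0 i) par_aff).
have E := derive_linear_mx l dF.
by rewrite [LHS](_ : _ = v2r (l ('D_(dir (delta_mx 0 i)) F (par x))) 0 j)// -E.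
Qed.

Lemma level_set_open : open (M `\` S : set (subspace M)).
Proof.
pose V := cor @^-1` (O `&` G @^-1` ~` [set 0]).
have oV : open V.
  apply: open_comp => [X _|]; first exact: cor_cts.
  rewrite openE => x [Ox Gx]; apply: filterI; first exact: open_nbhs_nbhs.
  apply: (smoothv_continuous smooth_G Ox).
  apply: open_nbhs_nbhs; split => //.
  apply: closed_openC; apply: accessible_closed_set1.
  apply: hausdorff_accessible.
  exact: norm_hausdorff.
apply/open_subspaceP; exists V => //.
rewrite eqEsubset; split=> X /= [].
  move=> [Ox Gx] MX; split=> //; split=> // -[_ FX].
  by apply: Gx; apply/G0; rewrite corK.
move=> [MX NS] _; split=> //; split=> /=; first by rewrite /O /= corK.
by move=> /G0; rewrite corK// => FX; exact: NS.
Qed.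

Let jac_neq0 x : O x -> jac G x != 0.
Proof. by move=> /rank_G rG; rewrite -mxrank_eq0 rG -lt0n. Qed.

Lemma level_set_dense : M `<=` closure (M `\` S).
Proof.
move=> X MX V /= /nbhs_interior nV; apply: contrapT => noV.
have Ox : O (cor X) by rewrite /O /= corK.
have oW : open (O `&` par @^-1` V^°).
  apply: openI => //; apply: open_comp; last exact: open_interior.
  by move=> x _; exact: par_cts.
have Wx : (O `&` par @^-1` V^°) (cor X).
  by split => //=; rewrite corK//; exact: nbhs_singleton.
have GW y : (O `&` par @^-1` V^°) y -> G y = cst 0 y.
  move=> [Oy Vy]; apply/G0; apply: contrapT => Fy; apply: noV.
  exists (par y); split; last exact: interior_subset.
  by split => // -[].
have /eqP := jac_neq0 Ox; apply.
by rewrite (jac_ext oW GW Wx); exact: (jac_cst 0).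
Qed.

(** In an arbitrary chart the set becomes a zero set of [H]; a nonzero entry of its Jacobian at each
    such zero gives content zero locally. *)
Lemma level_set_measure_zero : measure_zero M T S.
Proof.
move=> U phi [UM oU ophi sphi [psi psiK spsi]].
have psiU y : (phi @` U) y -> U (psi y) by move=> [X UX <-]; rewrite psiK.
pose H := G \o (cor \o psi).
have scp : smoothv (phi @` U) (cor \o psi).
  move=> j k.
  have sp a b : Ck (phi @` U) k (fun y => psi y a b).
    exact: Ck_on_Ck ophi (spsi k).
  rewrite (_ : (fun y => _) =
      fun y => codir T (psi y) 0 j + (codir T (- X0)) 0 j).
    apply: CkD => //; last exact: Ck_cst.
    exact: (@Ck_linear_mx _ _ _ _ _ _ _ (codir T) psi).
  by apply/funext => y; rewrite /= /cor linearD mxE.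
have cpO y : (phi @` U) y -> O ((cor \o psi) y).
  by move=> /psiU /UM MX; rewrite /O /= corK.
have sH : smoothv (phi @` U) H by exact: smoothv_comp cpO scp smooth_G.
have oU' : open (par @^-1` U).
  have [V oV VU] := (open_subspaceP _ _).1 oU.
  rewrite (_ : par @^-1` U = par @^-1` V `&` O).
    by apply: openI => //; apply: open_comp => // x _; exact: par_cts.
  rewrite eqEsubset; split=> x /=.
    move=> Ux; have : (U `&` M) (par x) by split=> //; exact: UM.
    by rewrite -VU.
  by move=> VO; have : (V `&` M) (par x) by []; rewrite VU => -[].
have sphip : smoothv (par @^-1` U) (phi \o par).
  move=> j k; apply: Ck_on_Ck oU' _.
  exact: (Ck_on_affine_comp par_aff (fun v _ => dir_mem v) par_cts) (sphi k).
apply: null_set_local => _ [X [UX SX] <-].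
have UpX : (par @^-1` U) (cor X) by rewrite /= corK//; exact: UM.
have phiX : (phi \o par) (cor X) = phi X by rewrite /= corK//; exact: UM.
have PX : (phi @` U) (phi X) by exists X.
have jH : jac H (phi X) != 0.
  (* Near [cor X] one has [G = H \o (phi \o par)], so a vanishing Jacobian of [H] would make that of
     [G] vanish. *)
  apply: contraTneq (jac_neq0 (_ : O (cor X))) => [jH0|]; last first.
    by rewrite /O /= corK//; exact: UM.
  rewrite negbK (@jac_ext _ _ _ _ _ (H \o (phi \o par)) _ oU' _ UpX).
    rewrite (jac_comp oU' ophi sphip sH UpX) phiX// jH0 mulmx0//.
  by move=> x Ux; rewrite /H /= psiK// parK.
have [i [j Hij]] : exists i j, jac H (phi X) i j != 0.
  apply: contrapT => N; move/eqP: jH; apply; apply/matrixP => i j.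
  rewrite [RHS]mxE; apply/eqP; apply: contrapT => /negP Nij; apply: N.
  by exists i, j.
rewrite mxE in Hij.
have [s s0 Hs] := zeros_content_zero ophi (sH j 1%N) PX Hij.
exists s => //; apply: content_zero_sub Hs => y [By [Y [UY SY] Yy]].
split => //=; rewrite -Yy /H /= psiK//.
have [MY FY] := SY; have /G0 -> : l (F (par (cor Y))) = 0 by rewrite corK.
by rewrite mxE.
Qed.

Lemma level_set_submanifold : embedded_submanifold M T S.
Proof.
split; first by move=> X [].
exists (\dim T - r)%N; first exact: leq_subr.
move=> X [MX FX].
have Ox : O (cor X) by rewrite /O /= corK.
have Gx : G (cor X) = 0 by apply/G0; rewrite corK.
have [N [th [ps [y0 [rho [[oN NO Nx rho0] [sth sps] thN psB zN]]]]]] :=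
  constant_rank_zeros open_O smooth_G rank_G Ox Gx.
(* The straightened zero set is the kernel of [jac G (cor X)]; [Q] turns it into a coordinate slice
   of dimension [\dim T - r]. *)
have [Q uQ sliceQ] := kernel_slice (jac G (cor X)).
rewrite (rank_G Ox) in sliceQ.
pose U := M `&` cor @^-1` N.
pose phi Y := th (cor Y) *m Q.
pose psi z := par (ps (z *m invmx Q)).
have imU : phi @` U = (mulmxr (invmx Q)) @^-1` ball y0 rho.
  rewrite eqEsubset; split=> [_ [Y [MY NY] <-]|z /= Bz].
    by rewrite /= /phi mulmxK//; have [] := thN _ NY.
  have [Np thp] := psB _ Bz; exists (psi z); last first.
    by rewrite /phi /psi parK thp mulmxKV.
  by split=> /=; [exact: (NO _ Np)|rewrite /psi parK].
have oim : open (phi @` U).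
  rewrite imU; apply: open_comp; last exact: ball_open.
  by move=> z _; exact: linear_mx_continuous.
exists U, phi; split.
- split.
  + by move=> Y [].
  + apply/open_subspaceP; exists (cor @^-1` N).
      by apply: open_comp => // Y _; exact: cor_cts.
    by rewrite /U setIC -setIA [_ `&` M]setIC setIA setIid.
  + exact: oim.
  + move=> k.
    apply: (Ck_on_affine_comp (L := cor) (l := codir T) (T' := fullv) (U' := N)
      (g := fun x => th x *m Q)) => //.
    * by move=> v _; exact: memvf.
    * by move=> Y [].
    * apply: smooth_on_fullv => // i j k'; rewrite ord1.
      exact: (smoothv_linear Q oN sth).
  + exists psi.
      move=> Y [MY NY]; rewrite /psi /phi mulmxK//.
      by have [_ ->] := thN _ NY; rewrite corK.
    apply: smooth_on_fullv => // i j k.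
    have sp : smoothv (phi @` U) (ps \o mulmxr (invmx Q)).
      apply: (@smoothv_comp _ _ _ _ _ (ball y0 rho)) => //.
      * exact: ball_open.
      * by rewrite imU.
      * exact: (smoothv_linear (invmx Q) oim (@smoothv_id _ _ _)).
    rewrite (_ : (fun z => _) = fun z => X0 i j +
        dir ((ps \o mulmxr (invmx Q)) z) i j); last first.
      by apply/funext => z; rewrite /psi /par mxE.
    apply: CkD => //; first exact: Ck_cst.
    apply: Ck_linear_mx => // a b; rewrite ord1; exact: sp.
- by split.
rewrite eqEsubset; split=> [_ [Y [UY [MY FY]] <-]|_ [[Y [MY NY] <-] sl]].
  split; first by exists Y.
  apply/sliceQ/(zN _ UY.2)/G0; by rewrite corK.
exists Y => //; split=> //; split=> //=.
by have /sliceQ/(zN _ NY)/G0 := sl; rewrite corK.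
Qed.

End LevelSet.

(** * The variance potential *)

Section Variance.
Context {R : realType}.

Lemma variance_ofE n (w a : 'rV[R]_n) : \sum_j w 0 j = 1 ->
  variance_of w a =
  \sum_j w 0 j * (a 0 j - \sum_i w 0 i * a 0 i) ^+ 2.
Proof.
move=> w1; rewrite /variance_of; set mu := \sum_i w 0 i * a 0 i.
rewrite [RHS](eq_bigr (fun j => w 0 j * a 0 j ^+ 2 - 2 * mu * (w 0 j * a 0 j) +
  mu ^+ 2 * w 0 j)); last by move=> j _; ring.
rewrite big_split sumrB -!mulr_sumr w1 -/mu /=. ring.
Qed.

Lemma variance_of_ge0 n (w a : 'rV[R]_n) : (forall j, 0 < w 0 j) ->
  \sum_j w 0 j = 1 -> 0 <= variance_of w a.
Proof.
move=> w0 w1; rewrite variance_ofE// sumr_ge0// => j _.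
by rewrite mulr_ge0 ?sqr_ge0// ltW.
Qed.

Lemma variance_of_eq0 n (w a : 'rV[R]_n) : (forall j, 0 < w 0 j) ->
  \sum_j w 0 j = 1 -> variance_of w a = 0 <-> exists c, forall j, a 0 j = c.
Proof.
move=> w0 w1; split=> [|[c ac]].
  rewrite variance_ofE// => /eqP; rewrite psumr_eq0 => [/allP a0|j _].
    exists (\sum_i w 0 i * a 0 i) => j.
    have := a0 j (mem_index_enum _).
    by rewrite mulf_eq0 gt_eqF//= sqrf_eq0 subr_eq0 => /eqP.
  by rewrite mulr_ge0 ?sqr_ge0// ltW.
rewrite /variance_of; under eq_bigr do rewrite ac.
under [X in _ - X ^+ 2]eq_bigr do rewrite ac.
by rewrite -!mulr_suml w1 !mul1r subrr.
Qed.

Lemma proj_T0E m n (A : 'M[R]_(m, n)) i j :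
  proj_T0 A i j = A i j - n%:R^-1 * \sum_k A i k.
Proof.
rewrite /proj_T0 mulmxBr mulmx1 -scalemxAr mulmxA !mxE big_ord1 !mxE mulr1.
by congr (_ - _ * _); apply: eq_bigr => k _; rewrite mxE mulr1.
Qed.

Lemma proj_T0_row_eq0 m n (A : 'M[R]_(m, n)) : (0 < n)%N ->
  proj_T0 A = 0 <-> forall i, exists c, forall j, A i j = c.
Proof.
move=> n0; split=> [/matrixP PA i|cA].
  exists (n%:R^-1 * \sum_k A i k) => j; have := PA i j; rewrite proj_T0E mxE.
  by move/eqP; rewrite subr_eq0 => /eqP.
apply/matrixP => i j; rewrite proj_T0E mxE; have [c Ac] := cA i.
under eq_bigr do rewrite Ac.
rewrite sumr_const card_ord -[c *+ _]mulr_natl.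
by rewrite mulKf ?pnatr_eq0 -?lt0n// Ac subrr.
Qed.

Lemma mane_critE m n (F : 'M[R]_(m, n) -> 'M[R]_(m, n)) : (0 < n)%N ->
  mane_crit F = assignment_manifold R m n `&` [set W | proj_T0 (F W) = 0].
Proof.
move=> n0; rewrite eqEsubset; suff H W : assignment_manifold R m n W ->
    potential F W = 0 <-> proj_T0 (F W) = 0.
  by split=> W [MW /(H W MW) HW].
move=> [Wpos W1]; have pos k j : 0 < (row k W) 0 j by rewrite mxE.
have sum1 k : \sum_j (row k W) 0 j = 1.
  move/matrixP/(_ k 0): W1; rewrite !mxE => <-; apply: eq_bigr => j _.
  by rewrite !mxE mulr1.
rewrite proj_T0_row_eq0// /potential; split=> [/eqP|cF].
  (* A vanishing sum of nonnegative variances has only vanishing terms. *)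
  rewrite oppr_eq0 mulf_eq0 invr_eq0 pnatr_eq0/= psumr_eq0; last first.
    by move=> k _; exact: variance_of_ge0.
  move=> /allP H i; have /eqP/(variance_of_eq0 _ (pos i) (sum1 i))[c rc] :=
    H i (mem_index_enum _).
  by exists c => j; rewrite -(rc j) mxE.
rewrite big1 ?mulr0 ?oppr0// => k _; apply/variance_of_eq0 => //.
by have [c rc] := cF k; exists c => j; rewrite mxE.
Qed.

End Variance.

(** * The assignment manifold as an open part of an affine subspace *)

Lemma open_pos_mx (R : realType) m n :
  open [set W : 'M[R]_(m, n) | forall i j, 0 < W i j].
Proof.
rewrite openE => W Wpos; exists (fun _ _ => [set y : R | 0 < y]) => //= i j.
by apply: open_nbhs_nbhs; split; [exact: open_gt|exact: Wpos].
Qed.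

Theorem proposition4p1 (R : realType) (m n : nat) (hm : (0 < m)%N)
    (hn : (0 < n)%N) (F : 'M[R]_(m, n) -> 'M[R]_(m, n)) (r : nat)
    (smoothF : smooth_on (T0 R m n) (assignment_manifold R m n) F)
    (hr : (1 <= r)%N)
    (rankF : forall W, assignment_manifold R m n W ->
       rank_differential (T0 R m n) (proj_T0 \o F) W = r) :
  let Q := assignment_manifold R m n `\` mane_crit F in
  [/\ embedded_submanifold (assignment_manifold R m n) (T0 R m n) (mane_crit F),
      measure_zero (assignment_manifold R m n) (T0 R m n) (mane_crit F),
      open (Q : set (subspace (assignment_manifold R m n))) &
      assignment_manifold R m n `<=` closure Q].
Proof.
move=> Q; rewrite /Q mane_critE// {Q}.
(* The barycentre serves as origin of the affine space of matrices with unit row sums. *)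
pose X0 : 'M[R]_(m, n) := const_mx n%:R^-1.
have X01 : X0 *m (const_mx 1 : 'cV[R]_n) = (const_mx 1 : 'cV[R]_m).
  apply/matrixP => i j; rewrite !mxE.
  under eq_bigr do rewrite !mxE mulr1.
  by rewrite sumr_const card_ord -[_^-1 *+ _]mulr_natl mulfV// pnatr_eq0 -lt0n.
have affM X : assignment_manifold R m n X -> X - X0 \in T0 R m n.
  by move=> [_ X1]; rewrite mem_T0 mulmxBl X1 X01 subrr.
have oM : open
    [set x | assignment_manifold R m n (X0 + @dir R m n (T0 R m n) x)].
  (* On [X0 + T0] the row sums are automatically 1; only positivity remains, an open condition. *)
  rewrite (_ : mkset _ = (fun x => X0 + @dir R m n (T0 R m n) x) @^-1`
      [set W | forall i j, 0 < W i j]).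
    apply: open_comp => [x _|]; last exact: open_pos_mx.
    apply: (@cvgD _ _ _ _ (nbhs_filter x)); first exact: cst_continuous.
    exact: linear_mx_continuous.
  rewrite eqEsubset; split=> x; first by case.
  move=> xpos; split=> //; have := dir_mem x; rewrite mem_T0 => /eqP dx.
  by rewrite mulmxDl X01 dx addr0.
(* This is [proj_T0], presented with its linear structure. *)
pose l : {linear 'M[R]_(m, n) -> 'M[R]_(m, n)} :=
  mulmxr (1%:M -
    n%:R^-1 *: ((const_mx 1 : 'cV[R]_n) *m (const_mx 1 : 'rV[R]_n))).
split.
- exact: (level_set_submanifold (l := l) affM oM smoothF rankF).
- exact: (level_set_measure_zero (l := l) affM oM smoothF rankF hr).
- exact: (level_set_open (l := l) affM oM smoothF).
- exact: (level_set_dense (l := l) affM oM smoothF rankF hr).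
Qed.
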